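(* Let $X$ be an analytic Borel space with a positive Borel measure $\mu$. Let $S$ be a countable discrete semigroup with identity acting on $X$ from the right by Borel maps. Let $(X\rtimes S,\lambda,\mu)$ be the corresponding measure semigroupoid, where $\lambda^x=\delta_x\times(\text{counting measure on }S)$. Then $(X\rtimes S,\lambda,\mu)$ is Liouville if and only if it is Reiter.
   Context: An analytic Borel space is a measurable space isomorphic to an analytic subset (continuous image of a Polish space) of a Polish space with the relative Borel structure. A right action $(x,s)\mapsto x.s$ of $S$ (with identity $e$) on $X$ satisfies $x.e=x$ and $(x.s).t=x.(st)$. The semigroupoid $X\rtimes S$ is the small category with morphism set $X\times S$, object set $X$, source $\mathbf s(x,s)=x.s$, target $\mathbf t(x,s)=x$ and composition $(x,s)(x.s,t)=(x,st)$; the fibre over $x$ (the set of morphisms with target $x$) is $\{x\}\times S$, identified with $S$. Here $\delta_x$ is the point mass at $x$, and $\mu$ is a measure on the object set $X$. With these data the properties in question amount to the following. For a probability measure $\theta$ on $S$ and $s\in S$, $s\theta$ is the pushforward of $\theta$ under $t\mapsto st$; $\|\cdot\|$ is the total variation ($\ell^1$) norm. Reiter: there is a sequence $(\theta_n)_n$ of families $\theta_n=(\theta_n^x)_{x\in X}$ of probability measures on $S$ such that for all $n$ and $s\in S$ the map $x\mapsto\theta_n^x(s)$ is Borel, and $\lim_{n\to\infty}\int_X\sum_{s\in S}\|\theta_n^x-s\theta_n^{x.s}\|f(x,s)\,d\mu(x)=0$ for all $f\in L^1(X\times S,\mu\times\text{counting measure})$. Liouville: there is a family $\pi=(\pi_x)_{x\in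 X}$ of probability measures on $S$ with $x\mapsto\pi_x(s)$ Borel for every $s\in S$ such that for $\mu$-a.e. $x\in X$, every $f\in\ell^\infty(S)$ (complex-valued) satisfying $f(r)=\sum_{s\in S}f(rs)\,\pi_{x.r}(s)$ for all $r\in S$ is constant.
   Formalization: The measure μ is assumed σ-finite (and X nonempty); for arbitrary positive μ the claim fails: for one point of infinite measure and the free group on two generators acting trivially, Reiter holds vacuously but Liouville fails. *)

(* Defs.v *)
From HB Require Import structures.
From mathcomp Require Import all_boot all_order all_algebra.
From mathcomp Require Import all_classical all_reals all_analysis.
From mathcomp Require Import complex.

Set Implicit Arguments.
Unset Strict Implicit.
Unset Printing Implicit Defensive.
Import Order.TTheory GRing.Theory Num.Theory.
Import numFieldNormedType.Exports.
Local Open Scope classical_set_scope.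
Local Open Scope ring_scope.
Local Open Scope complex_scope.

(* The types are pointed, so the empty Polish space is missing. A Hausdorff
   pseudometric is a metric. *)
Definition polish (R : realType) (P : completePseudoMetricType R) : Prop :=
  hausdorff_space P /\ exists2 D : set P, countable D & dense D.

Definition borel (T : topologicalType) : set (set T) := <<s @open T >>.

(* The clause [A = set0] is the image of the empty Polish space. *)
Definition analytic_set (R : realType) (P : completePseudoMetricType R)
    (A : set P) : Prop :=
  A = set0 \/
  exists (Q : completePseudoMetricType R) (g : Q -> P),
    [/\ polish Q, continuous g & range g = A].

Definition analytic_borel_space (R : realType) d (X : measurableType d) :
    Prop :=
  exists (P : completePseudoMetricType R) (A : set P) (h : X -> P),
    [/\ polish P, analytic_set A, set_bij [set: X] A h &
        forall B : set X,
          measurable B <-> exists2 C, borel C & h @` B = A `&` C].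

#[short(type="countMonoidType")]
HB.structure Definition CountMonoid := {S of Countable S & Monoid S}.

Definition discrete (S : Type) : Type := S.

Section discrete_instances.
Variable S : countMonoidType.

HB.instance Definition _ := CountMonoid.on (discrete S).
HB.instance Definition _ := isPointed.Build (discrete S) (1%g : S).
HB.instance Definition _ := @isMeasurable.Build default_measure_display
  (discrete S) discrete_measurable discrete_measurable0
  discrete_measurableC discrete_measurableU.

Variable R : realType.

(* An alias, because the library already attaches a sigma-finite structure on
   [nat] to [counting]. *)
Definition dcounting : set (discrete S) -> \bar R := @counting (discrete S) R.

HB.instance Definition _ := Measure.copy dcounting (@counting (discrete S) R).

Lemma sigma_finite_dcounting : sigma_finite [set: discrete S] dcounting.
Proof.
exists (fun n => [set s : discrete S | pickle s = n]).
  by apply/seteqP; split => // s _; exists (pickle s).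
move=> n; split => //; rewrite /dcounting /counting asboolT ?ltry//.
have [[s sn]|ns] := pselect (exists s : discrete S, pickle s = n).
  apply: (sub_finite_set _ (finite_set1 s)) => t /= tn.
  by apply: (pcan_inj (@pickleK (discrete S))); rewrite tn sn.
rewrite (_ : mkset _ = set0); first exact: finite_set0.
by apply/seteqP; split => // s /= sn; apply: ns; exists s.
Qed.

HB.instance Definition _ := @Measure_isSigmaFinite.Build _ _ _ dcounting
  sigma_finite_dcounting.

End discrete_instances.
Arguments dcounting : clear implicits.

Record right_borel_action d (X : measurableType d) (S : countMonoidType)
    (act : X -> S -> X) : Prop := {
  right_act1 : forall x, act x 1%g = x ;
  right_actM : forall x s t, act (act x s) t = act x (s * t)%g ;
  measurable_right_act : forall s, measurable_fun [set: X] (act^~ s) }.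

Section complex_integral.
Context d (T : measurableType d) (R : realType) (m : {measure set T -> \bar R}).

Definition cintegrable (f : T -> R[i]) : Prop :=
  m.-integrable [set: T] (EFin \o (@complex.Re R) \o f) /\
  m.-integrable [set: T] (EFin \o (@complex.Im R) \o f).

Definition cintegral (f : T -> R[i]) : R[i] :=
  (\int[m]_x complex.Re (f x)) +i* (\int[m]_x complex.Im (f x)).

End complex_integral.

(* The sum of an absolutely summable family, as an integral with respect to
   the counting measure; a family which is not absolutely summable gets an
   unspecified value. *)
Definition csum (R : realType) (S : countMonoidType)
    (a : discrete S -> R[i]) : R[i] :=
  cintegral (dcounting S R) a.

Section measures_on_semigroup.
Context (R : realType) (S : countMonoidType).
Implicit Types (p : probability (discrete S) R)
  (nu : set (discrete S) -> \bar R).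

Definition mass nu (s : discrete S) : R := fine (nu [set s]).

Definition translate (s : S) p : set (discrete S) -> \bar R :=
  pushforward p (fun t : discrete S => (s * t)%g : discrete S).

Definition l1dist nu1 nu2 : R :=
  fine (\esum_(t in [set: discrete S]) `|mass nu1 t - mass nu2 t|%:E).

End measures_on_semigroup.

Section properties.
Context (R : realType) d (X : measurableType d) (S : countMonoidType).
Variables (mu : {measure set X -> \bar R}) (act : X -> S -> X).

Definition borel_family (p : X -> probability (discrete S) R) : Prop :=
  forall s : S, measurable_fun [set: X] (fun x => mass (p x) s).

(* Class representatives of L^1(X * S) are used. The complex integrals tend to 0
   in modulus, since [R[i]] carries no topology here. *)
Definition reiter : Prop :=
  exists theta : nat -> X -> probability (discrete S) R,
    (forall n, borel_family (theta n)) /\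
    forall f : X * discrete S -> R[i],
      cintegrable (mu \x dcounting S R)%E f ->
      Normc.normc (cintegral mu (fun x => csum (fun s : discrete S =>
        (l1dist (theta n x) (translate s (theta n (act x s))))%:C * f (x, s))))
        @[n --> \oo] --> (0 : R).

(* [f] lives on the fibre {x} * S, identified with S; right multiplication by s
   moves (x, r) to (x, r s), and the source of (x, r) is [act x r]. *)
Definition fibre_harmonic (p : X -> probability (discrete S) R) (x : X)
    (f : S -> R[i]) : Prop :=
  forall r : S, f r =
    csum (fun s : discrete S => f (r * s)%g * (mass (p (act x r)) s)%:C).

Definition liouville : Prop :=
  exists2 p : X -> probability (discrete S) R,
    borel_family p &
    {ae mu, forall x, forall f : S -> R[i],
      (exists M : R, forall s, Normc.normc (f s) <= M) -> fibre_harmonic p x f ->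
      exists c : R[i], forall s, f s = c}.

End properties.

(* Main.v *)
Require Import Defs.
From mathcomp Require Import all_boot all_order all_algebra.
From mathcomp Require Import all_classical all_reals all_analysis.
From mathcomp Require Import measurable_realfun.
From mathcomp Require Import complex ring lra.
From mathcomp Require finmap.

Set Implicit Arguments.
Unset Strict Implicit.
Unset Printing Implicit Defensive.
Import Order.TTheory GRing.Theory Num.Theory.
Import numFieldNormedType.Exports.
Local Open Scope classical_set_scope.
Local Open Scope ring_scope.

(** Fix x in X. A family p of probability measures on S gives a random walk on
    the fibre over x: from r it moves to r s, where s has law p (x.r). Its
    Markov operator is written [avg p x]. The Liouville property asks that for
    some p the bounded functions fixed by [avg p x] be constant, for almost
    every x. Since [avg theta x u 1] and [avg theta x u s] are the integrals of
    u against theta^x and s theta^{x.s}, the Reiter property asks that the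
    total variation distance of these two measures, here called the defect of
    theta at (x, s), tend to 0 along a sequence of families. Both properties
    thus compare Markov operators on one and the same fibre.

    Liouville implies Reiter. Let theta_n be the Abel mean (1 - a) (1 + a P +
    a^2 P^2 + ...) of the walk P of p, with a = 1 - 1/(n+1). If the defect of
    theta_n at (x, s) stayed away from 0, there would be sets A_n such that g_n
    = theta_n 1_{A_n} separates 1 from s by a fixed amount. The resolvent
    equation gives |g_n - P g_n| <= 1 - a, hence a pointwise limit of a
    subsequence of g_n is a bounded harmonic function which is not constant
    ([liouville_defect]). So the defect tends to 0 for every s and almost every
    x, and dominated convergence gives the integral form of the Reiter
    property.

    Reiter implies Liouville. This is the construction of Kaimanovich and
    Vershik: take pi = sum_j w_j theta_{nu j} with fixed positive weights w_j
    and a rapidly increasing speed nu. Write the operator of pi as Q + N, where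
    Q collects the terms j < K and N the others, and let tau be the total
    weight of N. The Green operator G = tau (1 - Q)^{-1} averages against
    probability measures, and h = (Q + N) h becomes tau h = G N h
    ([green_harmonic]). The function N h takes nearly the same value at 1 and
    at t as soon as the defects of theta_{nu j} at (x, t), j >= K, are small;
    so if the averages of these defects under G at s are small, then h(s) is
    nearly equal to a constant independent of s ([green_oscillation]).

    The speed nu may not depend on x, because the walk on the fibre over x uses
    the measures pi at all points x.r. It is therefore chosen so that the
    integrals over x of the averaged defects are summable ([fast_speed]). Since
    the measure defining G depends only on the values of nu below K, this
    choice can be made recursively: the Reiter property is applied with a test
    function f(x, t) which is the mass at t of the measure defining G, cut off
    to a set of points x of finite measure. The averaged defects then tend to 0
    for almost every x. *)

(** * Integration on a countable discrete space *)

Section integration_on_discrete.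
Context (R : realType) (S : countMonoidType).
Local Notation T := (discrete S).
Implicit Types (m : {measure set T -> \bar R}) (p q : probability T R).

(** The sets of this partition of S are singletons or empty. Indexing it by nat
    turns integrals over S into series, to which the measurability lemmas for
    countable sums apply. *)
Definition cell (n : nat) : set T := [set s : T | pickle s = n].
Definition point_of (n : nat) : T := odflt (1%g : S) (unpickle n).

Lemma cellE n s : cell n s -> s = point_of n.
Proof. by rewrite /cell /point_of /= => <-; rewrite pickleK. Qed.

Lemma cell_pickle s : cell (pickle s) = [set s].
Proof.
apply/seteqP; split => t /=; last by move=> ->.
exact: (pcan_inj (@pickleK T)).
Qed.

Lemma point_of_pickle s : point_of (pickle s) = s.
Proof. by rewrite /point_of pickleK. Qed.

Lemma trivIset_cell : trivIset setT cell.
Proof. by move=> i j _ _ [s []] /= <- <-. Qed.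

Lemma bigcup_cell : \bigcup_n cell n = setT.
Proof. by apply/seteqP; split => // s _; exists (pickle s). Qed.

Local Open Scope ereal_scope.

Lemma integral_discrete m (g : T -> \bar R) : (forall s, 0 <= g s) ->
  \int[m]_s g s = \sum_(n <oo) m (cell n) * g (point_of n).
Proof.
move=> g0; rewrite -bigcup_cell ge0_integral_bigcup//; last exact: trivIset_cell.
apply: eq_eseriesr => n _.
rewrite (eq_integral (cst (g (point_of n)))); last first.
  by move=> s; rewrite inE => /cellE ->.
by rewrite integral_cst// muleC.
Qed.

Lemma measurable_integral_discrete d (X : measurableType d)
    (m : X -> {measure set T -> \bar R}) (g : X -> T -> \bar R) :
  (forall x s, 0 <= g x s) ->
  (forall s, measurable_fun [set: X] (fun x => m x [set s])) ->
  (forall s, measurable_fun [set: X] (g^~ s)) ->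
  measurable_fun [set: X] (fun x => \int[m x]_s g x s).
Proof.
move=> g0 mm mg.
rewrite (_ : (fun x => _) =
  fun x => \sum_(n <oo) m x (cell n) * g x (point_of n)); last first.
  by apply/funext => x; rewrite integral_discrete.
apply: ge0_emeasurable_sum => [n x _ _|n _]; first by rewrite mule_ge0.
apply: emeasurable_funM => //.
have [[s sn]|ns] := pselect (exists s : T, pickle s = n).
  by rewrite (_ : (fun _ => _) = fun x => m x [set s]) // -sn cell_pickle.
rewrite (_ : (fun _ => _) = cst 0) //; apply/funext => x.
rewrite (_ : cell n = set0) ?measure0//.
by apply/seteqP; split => // s /= sn; apply: ns; exists s.
Qed.

Lemma dcounting_set1 s :
  (dcounting S R : {measure set T -> \bar R}) [set s] = 1.
Proof.
rewrite /= /dcounting /counting asboolT; last exact: finite_set1.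
by rewrite fset_set1 finmap.cardfs1.
Qed.

Lemma ge0_integral_counting m (g : T -> \bar R) : (forall s, 0 <= g s) ->
  \int[m]_s g s = \int[dcounting S R]_s (g s * m [set s]).
Proof.
move=> g0; rewrite !integral_discrete//; last by move=> s; rewrite mule_ge0.
apply: eq_eseriesr => n _.
have [[s sn]|ns] := pselect (exists s : T, pickle s = n).
  rewrite -sn cell_pickle point_of_pickle muleC.
  by rewrite dcounting_set1 mul1e.
rewrite (_ : cell n = set0) ?measure0 ?mul0e//.
by apply/seteqP; split => // s /= sn; apply: ns; exists s.
Qed.

Lemma esum_counting (g : T -> \bar R) : (forall s, 0 <= g s) ->
  \esum_(s in [set: T]) g s = \int[dcounting S R]_s g s.
Proof.
move=> g0; rewrite integral_discrete// -bigcup_cell.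
rewrite esum_bigcupT//; last exact: trivIset_cell.
rewrite nneseries_esumT; last by move=> n; rewrite mule_ge0.
apply: eq_esum => n _.
have [[s sn]|ns] := pselect (exists s : T, pickle s = n).
  rewrite -sn cell_pickle point_of_pickle esum_set1//.
  by rewrite dcounting_set1 mul1e.
rewrite (_ : cell n = set0) ?measure0 ?mul0e ?esum_set0//.
by apply/seteqP; split => // s /= sn; apply: ns; exists s.
Qed.

Lemma measure_probability (m : {measure set T -> \bar R}) : m setT = 1 ->
  exists p : probability T R, forall A, p A = m A.
Proof.
move=> m1.
exists (mnormalize m (@dirac _ T (1%g : S) R)) => A.
by rewrite /= /mnormalize m1 onee_eq0/= invr1 mule1.
Qed.

Lemma ge0_eq_measure_integral_discrete m m' (g : T -> \bar R) :
  (forall s, 0 <= g s) -> (forall A, m A = m' A) ->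
  \int[m]_s g s = \int[m']_s g s.
Proof.
move=> g0 mm'; rewrite !integral_discrete//.
by apply: eq_eseriesr => n _; rewrite mm'.
Qed.

(** Every law needed below is such a mixture. It is characterised by the
    integrals of nonnegative functions, which is the only way in which it is
    used. *)
Lemma mixture_exists (w : nat -> R) (nu : nat -> probability T R) :
  (forall n, (0 <= w n)%R) -> \sum_(n <oo) (w n)%:E = 1 ->
  exists p : probability T R, forall g : T -> \bar R, (forall s, 0 <= g s) ->
    \int[p]_s g s = \sum_(n <oo) (w n)%:E * \int[nu n]_s g s.
Proof.
move=> w0 w1.
pose m n : {measure set T -> \bar R} := mscale (NngNum (w0 n)) (nu n).
have [|p pE] := @measure_probability (mseries m 0).
  rewrite /mseries -w1; apply: eq_eseriesr => n _.
  by rewrite [LHS](_ : _ = (w n)%:E * nu n setT)// probability_setT mule1.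
exists p => g g0.
rewrite (ge0_eq_measure_integral_discrete g0 pE).
rewrite ge0_integral_measure_series//.
apply: eq_eseriesr => n _.
by rewrite ge0_integral_mscale.
Qed.

(** The law of a point chosen in two stages; on a countable space it is a
    mixture over the cells, with weights their masses. *)
Lemma bind_exists p (k : T -> probability T R) :
  exists q : probability T R, forall g : T -> \bar R, (forall s, 0 <= g s) ->
    \int[q]_s g s = \int[p]_s \int[k s]_t g t.
Proof.
have pfin n : p (cell n) \is a fin_num by exact: fin_num_measure.
have [| |q qE] := @mixture_exists (fun n => fine (p (cell n))) (k \o point_of).
- by move=> n; rewrite fine_ge0.
- rewrite -[RHS](@probability_setT _ _ _ p) -[RHS]mul1e -integral_cst//.
  rewrite integral_discrete//; apply: eq_eseriesr => n _.
  by rewrite mule1 fineK.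
exists q => g g0; rewrite qE// integral_discrete; last first.
  by move=> s; apply: integral_ge0.
by apply: eq_eseriesr => n _; rewrite fineK.
Qed.

Lemma translate_exists (s : S) p :
  exists q : probability T R,
    (forall A, q A = translate s p A) /\
    forall g : T -> \bar R, (forall t, 0 <= g t) ->
      \int[q]_t g t = \int[p]_t g (s * t)%g.
Proof.
have [q qE] := @bind_exists p (fun t => @dirac _ T (s * t)%g R).
have qE' g : (forall t, 0 <= g t) -> \int[q]_t g t = \int[p]_t g (s * t)%g.
  move=> g0; rewrite qE//; apply: eq_integral => t _.
  rewrite integral_dirac//.
  by rewrite diracT mul1e.
exists q; split => // A; rewrite /translate /pushforward.
rewrite -[LHS]mul1e -integral_cst// integral_mkcond qE'; last first.
  by move=> t; rewrite patchE; case: ifP.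
rewrite -[RHS]mul1e -integral_cst// [RHS]integral_mkcond.
apply: eq_integral => t _; rewrite !patchE.
have [At|At] := boolP ((s * t)%g \in A).
  by rewrite mem_set//; move: At; rewrite inE.
by rewrite memNset//= => At'; move/negP: At; apply; rewrite inE.
Qed.

End integration_on_discrete.

(** * Total variation of probability measures on S *)

Section l1_distance.
Context (R : realType) (S : countMonoidType).
Local Notation T := (discrete S).
Implicit Types (p q : probability T R).
Local Open Scope ereal_scope.

Lemma massE p s : (mass p s)%:E = p [set s].
Proof. by rewrite /mass fineK// fin_num_measure. Qed.

Lemma mass_ge0 p s : (0 <= mass p s)%R.
Proof. by rewrite /mass fine_ge0. Qed.

Lemma integral_mass p (g : T -> \bar R) : (forall s, 0 <= g s) ->
  \int[p]_s g s = \int[dcounting S R]_s (g s * (mass p s)%:E).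
Proof.
move=> g0; rewrite ge0_integral_counting//.
by apply: eq_integral => s _; rewrite massE.
Qed.

Lemma le_integral_discrete (m : {measure set T -> \bar R}) (g h : T -> \bar R) :
  (forall s, 0 <= g s) -> (forall s, g s <= h s) ->
  \int[m]_s g s <= \int[m]_s h s.
Proof. by move=> g0 gh; apply: ge0_le_integral. Qed.

Lemma integral_probability_cst p (c : \bar R) : 0 <= c ->
  \int[p]_s c = c.
Proof.
move=> c0; rewrite integral_cst// [X in c * X](_ : _ = 1) ?mule1//.
exact: probability_setT.
Qed.

Lemma l1distE p q :
  (l1dist p q)%:E = \int[dcounting S R]_s `|mass p s - mass q s|%:E.
Proof.
rewrite /l1dist esum_counting; last by move=> s; rewrite lee_fin.
rewrite fineK// ge0_fin_numE; last by apply: integral_ge0 => s _; rewrite lee_fin.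
apply: (@le_lt_trans _ _ (1 + 1)); last by rewrite -EFinD ltry.
have mass1 (r : probability T R) :
    \int[dcounting S R]_s (mass r s)%:E = 1 :> \bar R.
  rewrite -[RHS](integral_probability_cst r lee01) integral_mass//.
  by apply: eq_integral => s _; rewrite mul1e.
rewrite -[X in _ <= X + _](mass1 p) -[X in _ <= _ + X](mass1 q).
rewrite -ge0_integralD//; try by move=> s _; rewrite lee_fin mass_ge0.
apply: le_integral_discrete => s; first by rewrite lee_fin.
rewrite -EFinD lee_fin (le_trans (ler_normB _ _))//.
by rewrite !ger0_norm ?mass_ge0.
Qed.

Lemma l1dist_ge0 p q : (0 <= l1dist p q)%R.
Proof.
by rewrite -lee_fin l1distE; apply: integral_ge0 => s _; rewrite lee_fin.
Qed.

Lemma l1dist_sym p q : l1dist p q = l1dist q p.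
Proof.
apply/EFin_inj; rewrite !l1distE; apply: eq_integral => s _.
by rewrite distrC.
Qed.

(** Pointwise, u(t) p(t) <= u(t) q(t) + C |p(t) - q(t)|. *)
Lemma integral_l1dist p q (u : T -> \bar R) (C : R) :
  (forall s, 0 <= u s <= C%:E) ->
  \int[p]_s u s <= \int[q]_s u s + (C * l1dist p q)%:E.
Proof.
move=> uC.
have u0 s : 0 <= u s by case/andP: (uC s).
have C0 : (0 <= C)%R.
  by case/andP: (uC 1%g) => ? ?; rewrite -lee_fin; apply: le_trans; eassumption.
rewrite EFinM l1distE -ge0_integralZl//; try by move=> s _; rewrite lee_fin.
rewrite !integral_mass// -ge0_integralD//;
  try by move=> s _; rewrite ?mule_ge0// lee_fin ?mass_ge0.
apply: le_integral_discrete => s; first by rewrite mule_ge0// lee_fin mass_ge0.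
have /fineK : u s \is a fin_num.
  by rewrite ge0_fin_numE//; case/andP: (uC s) => _ /le_lt_trans -> //; rewrite ltry.
move: (uC s); move: (fine (u s)) => r + ur; rewrite -ur.
move=> /andP[]; rewrite !lee_fin => r0 rC.
have h1 := ler_norm (mass p s - mass q s)%R.
have h2 := normr_ge0 (mass p s - mass q s)%R.
nra.
Qed.

Lemma integral_indic_discrete p (A : set T) :
  \int[p]_s (\1_A s)%:E = p A.
Proof. by rewrite integral_indic// setIT. Qed.

Lemma probability_EFin p (A : set T) : exists a : R, p A = a%:E.
Proof. by exists (fine (p A)); rewrite fineK// fin_num_measure. Qed.

(** The set where p has at least the mass of q: the positive and negative parts
    of p - q have equal total mass, hence the factor 2. *)
Lemma l1dist_set p q : exists A : set T,
  l1dist p q = (2 * (fine (p A) - fine (q A)))%R.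
Proof.
pose A : set T := [set s | (mass q s <= mass p s)%R].
exists A; pose B := ~` A.
have eqn : (l1dist p q)%:E + (q A + p B) = p A + q B.
  rewrite l1distE -!integral_indic_discrete !integral_mass//.
  rewrite -!ge0_integralD//;
    try by move=> s _; rewrite ?adde_ge0 ?mule_ge0 ?lee_fin ?mass_ge0.
  apply: eq_integral => s _; rewrite /B !indicE in_setC.
  have [As|As] := boolP (s \in A).
    move: As; rewrite inE /A/= => As.
    by rewrite /= !mul0e !mul1e !adde0 -EFinD ger0_norm ?subr_ge0// subrK.
  move: As; rewrite notin_setE /A/= => /negP; rewrite -ltNge => As.
  rewrite /= !mul0e !mul1e !add0e -EFinD ltr0_norm ?subr_lt0//.
  by rewrite opprB subrK.
have pB : p B = 1 - p A by rewrite probability_setC.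
have qB : q B = 1 - q A by rewrite probability_setC.
move: eqn; rewrite pB qB.
have [a ->] := probability_EFin p A; have [b ->] := probability_EFin q A.
by rewrite -!EFinB -!EFinD => -[] /= ?; lra.
Qed.

Lemma l1dist_le2 p q : (l1dist p q <= 2)%R.
Proof.
have [A ->] := l1dist_set p q.
have : p A <= 1 by exact: probability_le1.
have : 0 <= q A by [].
have [a ->] := probability_EFin p A; have [b ->] := probability_EFin q A.
by rewrite !lee_fin /= => ? ?; lra.
Qed.

End l1_distance.

(** * Geometric mixtures and mixtures along a measure *)

Section mixtures.
Context (R : realType) (S : countMonoidType).
Local Notation T := (discrete S).
Implicit Types (p q : probability T R).
Local Open Scope ereal_scope.

Lemma geometric_weights (a : R) : (0 <= a < 1)%R ->
  \sum_(n <oo) ((1 - a) * a ^+ n)%:E = 1.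
Proof.
move=> /andP[a0 a1].
have na : (`|a| < 1)%R by rewrite ger0_norm.
apply/cvg_lim => //.
rewrite (_ : (fun n => _) = EFin \o series (geometric (1 - a) a)); last first.
  by apply/funext => n; rewrite /= /series/= sumEFin.
apply: cvg_EFin; first exact: nearW.
have := @cvg_geometric_series _ (1 - a)%R a na.
by rewrite divff// subr_eq0 gt_eqF.
Qed.

Lemma weight_ge0 (a : {x : R | (0 <= x < 1)%R}) n :
  0 <= ((1 - sval a) * sval a ^+ n)%:E.
Proof.
case: a => a /= /andP[a0 a1].
by rewrite lee_fin mulr_ge0 ?exprn_ge0// subr_ge0 ltW.
Qed.

(** The identity behind the resolvent equations. *)
Lemma geometric_split (a : {x : R | (0 <= x < 1)%R}) (f : nat -> \bar R) :
  (forall n, 0 <= f n) ->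
  \sum_(n <oo) ((1 - sval a) * sval a ^+ n)%:E * f n =
  (1 - sval a)%:E * f 0%N +
    (sval a)%:E * \sum_(n <oo) ((1 - sval a) * sval a ^+ n)%:E * f n.+1.
Proof.
move=> f0; have w0 := weight_ge0 a; move: w0; case: a => a /= _ w0.
rewrite nneseries_recl//; last by move=> n _; rewrite mule_ge0.
rewrite expr0 mulr1; congr (_ + _).
rewrite -(@nneseries_addn _ _ 1); last by move=> n; rewrite mule_ge0.
rewrite -nneseriesZl; last by move=> n _; rewrite mule_ge0.
apply: eq_eseriesr => n _; rewrite addn1 muleA -EFinM.
by congr (_%:E * _); rewrite exprS; ring.
Qed.

Lemma geomix_exists (a : {x : R | (0 <= x < 1)%R}) (nu : nat -> probability T R) :
  exists p : probability T R, forall g : T -> \bar R, (forall s, 0 <= g s) ->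
    \int[p]_s g s = \sum_(n <oo) ((1 - sval a) * sval a ^+ n)%:E * \int[nu n]_s g s.
Proof.
apply: mixture_exists; last exact: (geometric_weights (svalP a)).
by move=> n; have := weight_ge0 a n; rewrite lee_fin.
Qed.

Definition geomix a nu := sval (cid (@geomix_exists a nu)).

Lemma integral_geomix a nu (g : T -> \bar R) : (forall s, 0 <= g s) ->
  \int[geomix a nu]_s g s =
  \sum_(n <oo) ((1 - sval a) * sval a ^+ n)%:E * \int[nu n]_s g s.
Proof. by move=> g0; rewrite /geomix; case: cid => p /= ->. Qed.

Definition bind p k := sval (cid (@bind_exists R S p k)).

Lemma integral_bind p k (g : T -> \bar R) : (forall s, 0 <= g s) ->
  \int[bind p k]_s g s = \int[p]_s \int[k s]_t g t.
Proof. by move=> g0; rewrite /bind; case: cid => q /= ->. Qed.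

End mixtures.

(** * Markov operators on the fibres *)

Section markov_operators.
Context (R : realType) d (X : measurableType d) (S : countMonoidType).
Variable act : X -> S -> X.
Hypothesis hact : right_borel_action act.
Local Notation T := (discrete S).
Local Notation family := (X -> probability T R).
Implicit Types (p q : family) (x : X) (u v : T -> \bar R) (r s t : T).
Local Open Scope ereal_scope.

(** The Markov operator on the fibre over x. *)
Definition avg p x u r : \bar R := \int[p (act x r)]_t u (r * t)%g.

Lemma avg_ge0 p x u r : (forall s, 0 <= u s) -> 0 <= avg p x u r.
Proof. by move=> u0; apply: integral_ge0. Qed.

Lemma eq_avg p x u v r : u =1 v -> avg p x u r = avg p x v r.
Proof. by move=> uv; apply: eq_integral => t _; exact: uv. Qed.

Lemma le_avg p x u v r : (forall s, 0 <= u s) -> (forall s, u s <= v s) ->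
  avg p x u r <= avg p x v r.
Proof. by move=> u0 uv; apply: le_integral_discrete. Qed.

Lemma avg_cst p x (c : \bar R) r : 0 <= c -> avg p x (fun=> c) r = c.
Proof. exact: integral_probability_cst. Qed.

Lemma avg_le p x u r (c : \bar R) :
  (forall s, 0 <= u s) -> (forall s, u s <= c) -> avg p x u r <= c.
Proof.
move=> u0 uc; rewrite -[leRHS](avg_cst p x r (le_trans (u0 1%g) (uc 1%g))).
exact: le_avg.
Qed.

Lemma avgD p x u v r : (forall s, 0 <= u s) -> (forall s, 0 <= v s) ->
  avg p x (fun s => u s + v s) r = avg p x u r + avg p x v r.
Proof. by move=> u0 v0; rewrite /avg ge0_integralD. Qed.

Lemma avgZ p x u (c : \bar R) r : (forall s, 0 <= u s) -> 0 <= c ->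
  avg p x (fun s => c * u s) r = c * avg p x u r.
Proof. by move=> u0 c0; rewrite /avg ge0_integralZl. Qed.

Lemma avg_series p x (u : nat -> T -> \bar R) r : (forall n s, 0 <= u n s) ->
  avg p x (fun s => \sum_(n <oo) u n s) r = \sum_(n <oo) avg p x (u n) r.
Proof. by move=> u0; rewrite /avg integral_nneseries. Qed.

Lemma avg1 p x u : avg p x u (1%g : S) = \int[p x]_t u t.
Proof.
rewrite /avg (right_act1 hact); apply: eq_integral => t _.
by rewrite mul1g.
Qed.

Definition unit_family : family := fun=> @dirac _ T (1%g : S) R.

Lemma avg_unit x u r : avg unit_family x u r = u r.
Proof. by rewrite /avg integral_dirac// diracT mul1e mulg1. Qed.

(** A step of p followed by a step of q, the latter evaluated at the point of X
    which the first step reaches. *)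
Definition convolve p q : family := fun x =>
  bind (p x) (fun s => bind (q (act x s)) (fun t => @dirac _ T (s * t)%g R)).

Lemma avg_convolve p q x u r : (forall s, 0 <= u s) ->
  avg (convolve p q) x u r = avg p x (avg q x u) r.
Proof.
move=> u0; rewrite /avg integral_bind//; apply: eq_integral => s _.
rewrite integral_bind// (right_actM hact).
apply: eq_integral => t _.
by rewrite integral_dirac// diracT mul1e mulgA.
Qed.

Definition geomix_family a (nu : nat -> family) : family :=
  fun x => geomix a (fun n => nu n x).

Lemma avg_geomix a (nu : nat -> family) x u r : (forall s, 0 <= u s) ->
  avg (geomix_family a nu) x u r =
  \sum_(n <oo) ((1 - sval a) * sval a ^+ n)%:E * avg (nu n) x u r.
Proof. by move=> u0; rewrite /avg integral_geomix. Qed.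

Definition pow_family p n : family := iter n (convolve p) unit_family.

Lemma avg_powS p n x u r : (forall s, 0 <= u s) ->
  avg (pow_family p n.+1) x u r = avg p x (avg (pow_family p n) x u) r.
Proof. exact: avg_convolve. Qed.

Lemma avg_powSr p n x u r : (forall s, 0 <= u s) ->
  avg (pow_family p n.+1) x u r = avg (pow_family p n) x (avg p x u) r.
Proof.
move=> u0; have Pu0 s : 0 <= avg p x u s by exact: avg_ge0.
elim: n r => [|n ih] r.
  rewrite (avg_powS p 0 x r u0) avg_unit.
  by apply: eq_avg => s; exact: avg_unit.
transitivity (avg p x (avg (pow_family p n) x (avg p x u)) r); last first.
  exact/esym/avg_powS.
transitivity (avg p x (avg (pow_family p n.+1) x u) r); first exact: avg_powS.
by apply: eq_avg => s; exact: ih.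
Qed.

(** (1 - a) times the sum of a^l P^l over all l, as a family of probability
    measures. *)
Definition resolvent a p : family := geomix_family a (pow_family p).

(** The form which shows that Abel means are almost harmonic. *)
Lemma avg_resolvent_left a p x u r : (forall s, 0 <= u s) ->
  avg (resolvent a p) x u r =
  (1 - sval a)%:E * u r + (sval a)%:E * avg p x (avg (resolvent a p) x u) r.
Proof.
move=> u0; rewrite {1}/resolvent avg_geomix// geometric_split; last first.
  by move=> n; exact: avg_ge0.
rewrite avg_unit; congr (_ + _ * _).
rewrite (_ : avg (resolvent a p) x u = fun s =>
    \sum_(n <oo) ((1 - sval a) * sval a ^+ n)%:E * avg (pow_family p n) x u s);
  last by apply/funext => s; exact: avg_geomix.
rewrite avg_series; last by move=> n s; rewrite mule_ge0 ?weight_ge0 ?avg_ge0.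
apply: eq_eseriesr => n _.
rewrite avgZ ?weight_ge0//; last by move=> s; exact: avg_ge0.
by rewrite avg_powS.
Qed.

(** The form which inverts 1 - Q in [green_harmonic]. *)
Lemma avg_resolvent_right a p x u r : (forall s, 0 <= u s) ->
  avg (resolvent a p) x u r =
  (1 - sval a)%:E * u r + (sval a)%:E * avg (resolvent a p) x (avg p x u) r.
Proof.
move=> u0; rewrite {1}/resolvent avg_geomix// geometric_split; last first.
  by move=> n; exact: avg_ge0.
rewrite avg_unit; congr (_ + _ * _).
rewrite avg_geomix; last by move=> s; exact: avg_ge0.
by apply: eq_eseriesr => n _; rewrite avg_powSr.
Qed.

Lemma measurable_family_integral p (g : X -> T -> \bar R) : borel_family p ->
  (forall x s, 0 <= g x s) -> (forall s, measurable_fun [set: X] (g^~ s)) ->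
  measurable_fun [set: X] (fun x => \int[p x]_s g x s).
Proof.
move=> mp g0 mg; apply: measurable_integral_discrete => // s.
rewrite (_ : (fun _ => _) = EFin \o (fun x => mass (p x) s)).
  exact/measurable_EFinP/mp.
by apply/funext => x /=; rewrite massE.
Qed.

Lemma borel_family_integral p :
  (forall g : T -> \bar R, (forall s, 0 <= g s) ->
    measurable_fun [set: X] (fun x => \int[p x]_s g s)) ->
  borel_family p.
Proof.
move=> h s; rewrite (_ : (fun _ => _) =
    fine \o (fun x => \int[p x]_t (\1_[set s] t)%:E)).
  by apply: measurableT_comp => //; apply: h => t; rewrite lee_fin.
by apply/funext => x /=; rewrite integral_indic_discrete.
Qed.

Lemma borel_act p s : borel_family p -> borel_family (fun x => p (act x s)).
Proof.
move=> mp t; apply: (@measurableT_comp _ _ _ _ _ _ (fun x => mass (p x) t)).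
  exact: mp.
exact: (measurable_right_act hact).
Qed.

Lemma measurable_avg p (g : X -> T -> \bar R) r : borel_family p ->
  (forall x s, 0 <= g x s) -> (forall s, measurable_fun [set: X] (g^~ s)) ->
  measurable_fun [set: X] (fun x => avg p x (g x) r).
Proof.
move=> mp g0 mg.
apply: (measurable_family_integral (p := fun x => p (act x r))
  (g := fun x t => g x (r * t)%g)) => //.
exact: borel_act.
Qed.

Lemma borel_family_avg p :
  (forall g : T -> \bar R, (forall s, 0 <= g s) ->
    measurable_fun [set: X] (fun x => avg p x g (1%g : S))) ->
  borel_family p.
Proof.
move=> h; apply: borel_family_integral => g g0.
rewrite (_ : (fun _ => _) = fun x => avg p x g (1%g : S)); first exact: h.
by apply/funext => x; rewrite avg1.
Qed.

Lemma borel_unit : borel_family unit_family.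
Proof. by move=> s; exact: measurable_cst. Qed.

Lemma borel_convolve p q : borel_family p -> borel_family q ->
  borel_family (convolve p q).
Proof.
move=> mp mq; apply: borel_family_avg => g g0.
under eq_fun do rewrite avg_convolve//.
by apply: measurable_avg => // [x s|s]; [exact: avg_ge0|exact: measurable_avg].
Qed.

Lemma borel_geomix a (nu : nat -> family) : (forall n, borel_family (nu n)) ->
  borel_family (geomix_family a nu).
Proof.
move=> mnu; apply: borel_family_avg => g g0.
under eq_fun do rewrite avg_geomix//.
apply: ge0_emeasurable_sum => [n x _ _|n _].
  by rewrite mule_ge0 ?weight_ge0 ?avg_ge0.
apply: emeasurable_funM => //.
exact: measurable_avg.
Qed.

Lemma borel_pow p n : borel_family p -> borel_family (pow_family p n).
Proof. by move=> mp; elim: n => [|n ih]; [exact: borel_unit|exact: borel_convolve]. Qed.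

Lemma borel_resolvent a p : borel_family p -> borel_family (resolvent a p).
Proof. by move=> mp; apply: borel_geomix => n; exact: borel_pow. Qed.

Definition defect p x s : R := l1dist (p x) (translate s (p (act x s))).

Lemma translate_family p x s : exists q : probability T R,
  (forall u, (forall t, 0 <= u t) -> \int[q]_t u t = avg p x u s) /\
  defect p x s = l1dist (p x) q.
Proof.
have [q [qE qI]] := translate_exists s (p (act x s)).
exists q; split=> [u u0|]; first exact: qI.
by rewrite /defect (_ : translate _ _ = q)//; apply/funext => A; rewrite qE.
Qed.

Lemma defect_ge0 p x s : (0 <= defect p x s)%R.
Proof. by have [q [_ ->]] := translate_family p x s; exact: l1dist_ge0. Qed.

Lemma defect_le2 p x s : (defect p x s <= 2)%R.
Proof. by have [q [_ ->]] := translate_family p x s; exact: l1dist_le2. Qed.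

(** The two averages are the integrals of u against the measures whose distance
    is the defect. *)
Lemma le_avg_defect p x u s (C : R) : (forall t, 0 <= u t <= C%:E) ->
  avg p x u (1%g : S) <= avg p x u s + (C * defect p x s)%:E /\
  avg p x u s <= avg p x u (1%g : S) + (C * defect p x s)%:E.
Proof.
move=> uC; have [q [qI ->]] := translate_family p x s.
rewrite avg1 -qI; last by move=> t; case/andP: (uC t).
split; first exact: integral_l1dist.
by rewrite l1dist_sym; exact: integral_l1dist.
Qed.

Lemma defect_set p x s : exists A : set T,
  defect p x s = (2 * (fine (avg p x (EFin \o \1_A) (1%g : S)) -
    fine (avg p x (EFin \o \1_A) s)))%R.
Proof.
have [q [qI ->]] := translate_family p x s.
have [A ->] := l1dist_set (p x) q.
exists A; rewrite avg1 -qI; last by move=> t; rewrite lee_fin.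
by rewrite !integral_indic_discrete.
Qed.

(** The mass at t of s p (x.s) is the average of the indicator of t, which is
    measurable in x; the defect is a series of such terms. *)
Lemma measurable_defect p s : borel_family p ->
  measurable_fun [set: X] (fun x => defect p x s).
Proof.
move=> mp.
pose F x := \int[dcounting S R]_t
  `|mass (p x) t - fine (avg p x (EFin \o \1_[set t]) s)|%:E.
rewrite (_ : (fun x => _) = fine \o F); last first.
  apply/funext => x /=; rewrite -[LHS]/(fine (defect p x s)%:E).
  have [q [qI ->]] := translate_family p x s.
  rewrite l1distE; congr fine; apply: eq_integral => t _.
  by rewrite -qI ?integral_indic_discrete// => t'; rewrite lee_fin.
apply: measurableT_comp => //.
apply: measurable_integral_discrete => [x t|t|t]; first by rewrite lee_fin.
- exact: measurable_cst.
- apply/measurable_EFinP; apply: measurableT_comp => //.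
  apply: measurable_funB; first exact: mp.
  apply: measurableT_comp => //; apply: measurable_avg => // x t'.
  by rewrite lee_fin.
Qed.

End markov_operators.

(** * Pointwise compactness of bounded functions *)

Section pointwise_subsequence.
Context (R : realType) (I : countType).
Local Notation space := (prod_topology (fun _ : I => R^o : topologicalType)).

(** Countability of I enters here: finitely many coordinates are controlled at
    a time, and each coordinate is controlled eventually. *)
Lemma nbhs_initial_coordinates (h : space) (e : R) m : 0 < e ->
  nbhs h [set f : space | forall i, (pickle i < m)%N -> `|f i - h i| < e].
Proof.
move=> e0; have FF := nbhs_filter h.
elim: m => [|m ih]; first by apply: (@nearW _ _ _ FF) => f i; rewrite ltn0.
have near_m : nbhs h [set f : space | forall i, pickle i = m -> `|f i - h i| < e].
  have [[j jm]|nj] := pselect (exists j : I, pickle j = m); last first.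
    by apply: (@nearW _ _ _ FF) => f i im; exfalso; apply: nj; exists i.
  have : nbhs (h j : R^o) [set y : R^o | `|y - h j| < e].
    by apply/nbhs_ballP; exists e => //= y; rewrite /ball/= distrC.
  move=> nj; have := @proj_continuous I (fun=> R^o : topologicalType) j h _ nj.
  apply: (@filterS _ _ FF) => f /= fj i im.
  by rewrite (_ : i = j)//; apply: (pcan_inj pickleK); rewrite im jm.
apply: (@filterS _ _ FF _ _ _ (@filterI _ _ FF _ _ ih near_m)) => f [fih fm] i.
by rewrite ltnS leq_eqVlt => /orP[/eqP|]; [exact: fm|exact: fih].
Qed.

(** A cluster point exists by compactness of the product of the unit intervals,
    and neighbourhoods shrinking to it pick out the subsequence. *)
Lemma pointwise_subsequence (g : nat -> I -> R) :
  (forall n i, 0 <= g n i <= 1) ->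
  exists (phi : nat -> nat) (h : I -> R),
    (forall k, (k <= phi k)%N) /\
    (forall i, g (phi k) i @[k --> \oo] --> h i).
Proof.
move=> g01.
have := @tychonoff I (fun=> R^o : topologicalType)
  (fun=> `[0, 1]%classic) (fun=> @segment_compact R 0 1).
move=> /(_ ((g : nat -> space) @ \oo) _)[].
  by exists 0%N => // n _ i; rewrite /= in_itv/=; exact: g01.
move=> h [_ hcl].
have ex k : exists n, (k <= n)%N /\
    forall i, (pickle i < k)%N -> `|g n i - h i| < k.+1%:R^-1.
  have e0 : (0 : R) < k.+1%:R^-1 by rewrite invr_gt0.
  have [] := hcl [set f | exists2 n, (k <= n)%N & f = g n] _ _
    (@nbhs_initial_coordinates h _ k e0).
    by exists k => // n /= kn; exists n.
  by move=> f [[n kn ->] Ukn]; exists n.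
have [phi phiP] := choice ex.
exists phi, h; split=> [k|i]; first by have [] := phiP k.
apply/cvgrPdist_lt => e e0.
near=> k.
rewrite distrC; have [_ gk] := phiP k.
apply: (lt_trans (gk i _)); near: k; first by exists (pickle i).+1.
exact: (near_infty_natSinv_lt (PosNum e0)).
Unshelve. all: end_near. Qed.

End pointwise_subsequence.

(** * Harmonic functions as real integral equations *)

Section harmonic_functions.
Context (R : realType) d (X : measurableType d) (S : countMonoidType).
Variable act : X -> S -> X.
Hypothesis hact : right_borel_action act.
Local Notation T := (discrete S).
Implicit Types (p : probability T R).

(** Both sides are the difference of the integrals of the positive and negative
    parts, to which [integral_mass] applies. *)
Lemma integral_mass_real p (u : T -> R) :
  \int[dcounting S R]_s (u s * mass p s) = \int[p]_s u s.
Proof.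
rewrite /Rintegral; congr fine; rewrite [LHS]integralE [RHS]integralE; congr (_ - _)%E.
  rewrite [RHS]integral_mass//; apply: eq_integral => s _.
  by rewrite !funeposE /= !EFinM maxe_pMl ?lee_fin ?mass_ge0// mul0e.
rewrite [RHS]integral_mass//; apply: eq_integral => s _.
by rewrite !funenegE -!EFinN /= -mulNr EFinM maxe_pMl ?lee_fin ?mass_ge0// mul0e.
Qed.

Lemma csum_mass p (f : T -> R[i]) :
  csum (fun s => f s * (mass p s)%:C)%C =
  ((\int[p]_s complex.Re (f s)) +i* (\int[p]_s complex.Im (f s)))%C.
Proof.
rewrite /csum /cintegral; congr (_ +i* _)%C; rewrite -integral_mass_real;
  congr fine; apply: eq_integral => s _; case: (f s) => a b /=; congr EFin.
  by rewrite mulr0 subr0.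
by rewrite mulr0 add0r mulrC.
Qed.

Lemma fibre_harmonicP (p : X -> probability T R) x (f : S -> R[i]) :
  fibre_harmonic act p x f <-> forall r : S,
    complex.Re (f r) = \int[p (act x r)]_s complex.Re (f (r * s)%g) /\
    complex.Im (f r) = \int[p (act x r)]_s complex.Im (f (r * s)%g).
Proof.
split=> hf r.
  have := hf r; rewrite csum_mass => fr.
  by split; rewrite {1}fr.
rewrite csum_mass; have [<- <-] := hf r.
by case: (f r).
Qed.

End harmonic_functions.

(** * From the Liouville property to convergence on one fibre *)

Section liouville_fibre.
Context (R : realType) d (X : measurableType d) (S : countMonoidType).
Variable act : X -> S -> X.
Hypothesis hact : right_borel_action act.
Local Notation T := (discrete S).
Local Notation family := (X -> probability T R).

Lemma avg_interval (p : family) x (u : T -> R) (r : T) (C : R) :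
  (forall s, 0 <= u s <= C) ->
  (avg act p x (EFin \o u) r \is a fin_num) /\
  0 <= fine (avg act p x (EFin \o u) r) <= C.
Proof.
move=> uC.
have h0 : (0 <= avg act p x (EFin \o u) r)%E.
  by apply: avg_ge0 => s; rewrite lee_fin; case/andP: (uC s).
have hC : (avg act p x (EFin \o u) r <= C%:E)%E.
  by apply: avg_le => s; rewrite lee_fin; case/andP: (uC s).
have fin : avg act p x (EFin \o u) r \is a fin_num.
  by rewrite ge0_fin_numE// (le_lt_trans hC)// ltry.
split=> //; rewrite fine_ge0//=.
by rewrite -lee_fin fineK.
Qed.

Lemma cvg_interval (g : nat -> T -> R) (h : T -> R) :
  (forall n s, 0 <= g n s <= 1) -> (forall s, g n s @[n --> \oo] --> h s) ->
  forall s, 0 <= h s <= 1.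
Proof.
move=> g01 gh s; apply/andP; split.
  by apply: (cvgr_to_ge (gh s)); apply: nearW => n; case/andP: (g01 n s).
by apply: (cvgr_to_le (gh s)); apply: nearW => n; case/andP: (g01 n s).
Qed.

Lemma avg_cvg (p : family) x (g : nat -> T -> R) (h : T -> R) (r : T) :
  (forall n s, 0 <= g n s <= 1) -> (forall s, g n s @[n --> \oo] --> h s) ->
  fine (avg act p x (EFin \o g n) r) @[n --> \oo] -->
    fine (avg act p x (EFin \o h) r).
Proof.
move=> g01 gh.
have h01 := cvg_interval g01 gh.
have [hfin _] := @avg_interval p x h r 1 h01.
apply: fine_cvg; rewrite fineK//.
have [//|//| | | |_ _] := @dominated_convergence _ T R (p (act x r)) setT
  measurableT (fun n t => (g n (r * t)%g)%:E) (fun t => (h (r * t)%g)%:E)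
  (cst 1%E).
- by apply: aeW => t _; apply: cvg_EFin; [exact: nearW|exact: gh].
- exact: finite_measure_integrable_cst.
- by apply: aeW => t n _; rewrite lee_fin ger0_norm; case/andP: (g01 n (r * t)%g).
by apply.
Qed.

Definition abel_parameter (n : nat) : {x : R | 0 <= x < 1}.
Proof.
exists (1 - n.+1%:R^-1).
by rewrite subr_ge0 invf_le1// ler1n/= ltrBlDr ltrDl invr_gt0.
Defined.

(** A defect which does not tend to 0 produces a bounded harmonic function
    taking different values at 1 and s. *)
Lemma liouville_defect (p : family) x :
  (forall f : S -> R[i], (exists M : R, forall s, Normc.normc (f s) <= M) ->
    fibre_harmonic act p x f -> exists c : R[i], forall s, f s = c) ->
  forall s, defect act (resolvent act (abel_parameter n) p) x s
    @[n --> \oo] --> (0 : R).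
Proof.
move=> liou s; apply: contrapT => ncv.
pose res n := resolvent act (abel_parameter n) p.
have [e e0 bad] : exists2 e : R, 0 < e &
    forall N, exists n, (N <= n)%N /\ e <= defect act (res n) x s.
  apply: contrapT => nex; apply: ncv; apply/cvgrPdist_lt => e e0.
  apply: contrapT => nn; apply: nex; exists e => // N.
  apply: contrapT => nN; apply: nn; exists N => // n /= Nn.
  rewrite sub0r normrN ger0_norm ?defect_ge0// ltNge; apply/negP => le_e.
  by apply: nN; exists n.
have [psi psiP] := choice bad.
have [A AP] := choice (fun N => defect_set hact (res (psi N)) x s).
pose g N (r : T) : R := fine (avg act (res (psi N)) x (EFin \o \1_(A N)) r).
have gap N : defect act (res (psi N)) x s = 2 * (g N (1%g : S) - g N s) := AP N.
have ind01 N t : 0 <= (\1_(A N) t : R) <= 1.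
  by rewrite indicE; case: (t \in _); rewrite /= ?lexx ?ler01.
have g01 N r : 0 <= g N r <= 1 by have [] := avg_interval (res (psi N)) x r (ind01 N).
have gfin N : avg act (res (psi N)) x (EFin \o \1_(A N)) = EFin \o g N.
  apply/funext => r; rewrite /g /= fineK//.
  by have [] := avg_interval (res (psi N)) x r (ind01 N).
(* The resolvent equation g = (1 - a) i + a m, with i and m in [0, 1]. *)
have g_almost N r : `|g N r - fine (avg act p x (EFin \o g N) r)| <= N.+1%:R^-1.
  have [mfin /andP[m0 m1]] := avg_interval p x r (g01 N).
  have ind0 t : (0 <= (\1_(A N) t : R)%:E)%E by rewrite lee_fin.
  have := avg_resolvent_left hact (abel_parameter (psi N)) p x r ind0.
  rewrite -/(res _) gfin -(fineK mfin) /= -!EFinM -EFinD => -[->].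
  set m := fine _ in m0 m1 *; set w : R := (psi N).+1%:R^-1.
  have w0 : 0 <= w by rewrite invr_ge0.
  have [psiN _] := psiP N.
  have wN : w <= N.+1%:R^-1 by rewrite lef_pV2 ?posrE// ler_nat ltnS.
  apply: le_trans wN; case/andP: (ind01 N r).
  move: (\1_(A N) r) => i i0 i1.
  rewrite (_ : _ - m = w * (i - m)); last by ring.
  rewrite normrM ger0_norm// ler_piMr// ler_norml; apply/andP; split; lra.
have [phi [h [phiP gh]]] := pointwise_subsequence g01.
have harm r : h r = fine (avg act p x (EFin \o h) r).
  have c1 := @avg_cvg p x _ h r (fun n => g01 (phi n)) gh.
  have c2 : g (phi n) r - fine (avg act p x (EFin \o g (phi n)) r)
      @[n --> \oo] --> h r - fine (avg act p x (EFin \o h) r).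
    by apply: cvgB => //; exact: gh.
  have c3 : g (phi n) r - fine (avg act p x (EFin \o g (phi n)) r)
      @[n --> \oo] --> (0 : R).
    apply/cvgrPdist_lt => e' e'0; near=> n.
    rewrite sub0r normrN (le_lt_trans (g_almost _ _))//.
    apply: (@le_lt_trans _ _ n.+1%:R^-1).
      by rewrite lef_pV2 ?posrE// ler_nat ltnS.
    by near: n; exact: (near_infty_natSinv_lt (PosNum e'0)).
  by apply/eqP; rewrite -subr_eq0; apply/eqP; exact: (norm_cvg_unique c2 c3).
have h01 := cvg_interval (fun n => g01 (phi n)) gh.
have [] := liou (fun t => (h t)%:C%C).
- exists 1 => t; rewrite /Normc.normc/= expr0n addr0 sqrtr_sqr.
  by case/andP: (h01 t) => h0 h1; rewrite ger0_norm.
- apply/fibre_harmonicP => r /=; split; first exact: harm.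
  by rewrite /Rintegral integral0.
move=> c hc.
have h1s : h (1%g : S) = h s.
  by have := hc (1%g : S); rewrite -(hc s) => -[].
have : e / 2 <= h (1%g : S) - h s.
  have gB : g (phi n) (1%g : S) - g (phi n) s @[n --> \oo] --> h (1%g : S) - h s.
    by apply: cvgB; exact: gh.
  apply: (cvgr_to_ge gB); apply: nearW => n.
  by have [_] := psiP (phi n); rewrite gap ler_pdivrMr// mulrC.
by rewrite h1s subrr leNgt divr_gt0.
Unshelve. all: by end_near. Qed.

End liouville_fibre.

(** * Integrals over X * S *)

Section integrals_on_product.
Context (R : realType) d (X : measurableType d) (S : countMonoidType).
Variable mu : {sigma_finite_measure set X -> \bar R}.
Local Notation T := (discrete S).
Local Notation nu := (dcounting S R).
Local Open Scope ereal_scope.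

(** Joint measurability is measurability in x since S is countable. *)
Lemma measurable_fun_sections d' (Y : measurableType d') (F : X * T -> Y) :
  (forall s, measurable_fun [set: X] (fun x => F (x, s))) ->
  measurable_fun [set: X * T] F.
Proof.
move=> mF _ B mB; rewrite setTI.
rewrite (_ : F @^-1` B =
  \bigcup_n (((fun x => F (x, @point_of S n)) @^-1` B) `*` @cell S n)); last first.
  apply/seteqP; split=> [[x s] /= Bxs|[x s] [n _] [/= Bx /cellE ->//]].
  by exists (pickle s) => //; split; rewrite //= point_of_pickle.
apply: bigcup_measurable => n _; apply: measurableX => //.
by rewrite -[X in measurable X]setTI; exact: mF.
Qed.

Lemma measurable_section (F : X * T -> \bar R) s :
  measurable_fun [set: X * T] F -> measurable_fun [set: X] (fun x => F (x, s)).
Proof. by move=> mF; apply: (measurableT_comp mF); exact: measurable_pair2. Qed.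

Lemma ge0_fubini_discrete (F : X * T -> \bar R) : measurable_fun [set: X * T] F ->
  (forall z, 0 <= F z) ->
  \int[mu \x nu]_z F z = \int[mu]_x \int[nu]_s F (x, s).
Proof. by move=> mF F0; rewrite fubini_tonelli1. Qed.

Lemma abse_fine (y : \bar R) : `|(fine y)%:E| <= `|y|.
Proof. by case: y => [r| |] //=; rewrite normr0 leey. Qed.

(** The real-valued inner integral is 0 where the extended one is infinite;
    this only decreases absolute values. *)
Lemma iterated_Rintegral_le (F : X * T -> R) :
  measurable_fun [set: X * T] F ->
  `|(\int[mu]_x \int[nu]_s F (x, s))%R|%:E <= \int[mu \x nu]_z `|F z|%:E.
Proof.
move=> mF; have mFE : measurable_fun [set: X * T] (EFin \o F) by exact/measurable_EFinP.
pose G x := (\int[nu]_s F (x, s))%R.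
have mI (H : X * T -> \bar R) : measurable_fun [set: X * T] H ->
    (forall z, 0 <= H z) -> measurable_fun [set: X] (fun x => \int[nu]_s H (x, s)).
  move=> mH H0; apply: measurable_integral_discrete => // s.
  exact: measurable_section.
have mG : measurable_fun [set: X] (EFin \o G).
  apply/measurable_EFinP; rewrite /G /Rintegral.
  apply: measurableT_comp => //.
  rewrite (_ : (fun _ => _) = fun x => \int[nu]_s (EFin \o F)^\+ (x, s) -
     \int[nu]_s (EFin \o F)^\- (x, s)); last first.
    apply/funext => x; rewrite integralE.
    by congr (_ - _); apply: eq_integral => s _; rewrite !(funeposE, funenegE).
  by apply: emeasurable_funB; apply: mI => //;
    [exact: measurable_funepos|exact: measurable_funeneg].
apply: (@le_trans _ _ (\int[mu]_x `|(EFin \o G) x|)).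
  apply: le_trans (le_abse_integral mu measurableT mG).
  exact: abse_fine.
have mN : measurable_fun [set: X * T] (fun z => `|F z|%:E).
  by apply/measurable_EFinP; exact: measurableT_comp.
rewrite ge0_fubini_discrete//.
apply: ge0_le_integral => //.
- exact: measurableT_comp.
- by apply: (mI (fun z => `|F z|%:E)) => // z; rewrite lee_fin.
- move=> x _; apply: le_trans (abse_fine _) _.
  exact: le_abse_integral.
Qed.

Lemma ae_product (P : X -> Prop) : {ae mu, forall x, P x} ->
  {ae mu \x nu, forall z : X * T, P z.1}.
Proof.
move=> [N [mN N0 sub]]; exists (N `*` setT); split.
- exact: measurableX.
- by rewrite product_measure1E// [X in X * _](_ : _ = 0) ?mul0e.
- by move=> [x s] /= Px; split => //; apply: sub.
Qed.

End integrals_on_product.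

Lemma sqrt_sum_sq_cvg0 (R : realType) (u v : nat -> R) :
  u n @[n --> \oo] --> (0 : R) -> v n @[n --> \oo] --> (0 : R) ->
  Num.sqrt (u n ^+ 2 + v n ^+ 2) @[n --> \oo] --> (0 : R).
Proof.
move=> u0 v0; rewrite -[X in _ --> X]sqrtr0.
apply: continuous_cvg; first exact: sqrt_continuous.
rewrite (_ : (fun n => _) = fun n => u n * u n + v n * v n); last first.
  by apply/funext => n; rewrite !expr2.
have := cvgD (cvgM u0 u0) (cvgM v0 v0); rewrite mulr0 addr0.
exact.
Qed.

Lemma csum_scale (R : realType) (S : countMonoidType) (D : discrete S -> R)
    (f : discrete S -> R[i]) :
  csum (fun s => (D s)%:C%C * f s) =
  ((\int[dcounting S R]_s (D s * complex.Re (f s))) +i*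
   (\int[dcounting S R]_s (D s * complex.Im (f s))))%C.
Proof.
rewrite /csum /cintegral; congr (_ +i* _)%C; apply: eq_Rintegral => s _;
  case: (f s) => a b /=; by rewrite mul0r ?subr0 ?addr0.
Qed.

(** * From almost everywhere convergence to the Reiter property *)

Section reiter_from_ae.
Context (R : realType) d (X : measurableType d) (S : countMonoidType).
Variables (mu : {sigma_finite_measure set X -> \bar R}) (act : X -> S -> X).
Hypothesis hact : right_borel_action act.
Local Notation T := (discrete S).
Local Notation family := (X -> probability T R).
Local Notation nu := (dcounting S R).

Lemma weighted_defect_cvg0 (theta : nat -> family) (u : X * T -> R) :
  (forall n, borel_family (theta n)) ->
  {ae mu, forall x, forall s, defect act (theta n) x s @[n --> \oo] --> (0 : R)} ->
  (mu \x nu)%E.-integrable [set: X * T] (EFin \o u) ->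
  (\int[mu]_x \int[nu]_s (defect act (theta n) x s * u (x, s)))
    @[n --> \oo] --> (0 : R).
Proof.
move=> mtheta cv iu.
pose D n (z : X * T) := defect act (theta n) z.1 z.2.
have mu_ : measurable_fun [set: X * T] u.
  by apply/measurable_EFinP; case/integrableP: iu.
have mD n : measurable_fun [set: X * T] (D n).
  by apply: measurable_fun_sections => s; exact: measurable_defect.
have mDu n : measurable_fun [set: X * T] (fun z => D n z * u z).
  exact: measurable_funM.
have [//|//| | | |_ _] := @dominated_convergence _ (X * T)%type R (mu \x nu)%E setT
  measurableT (fun n z => `|D n z * u z|%:E) (cst 0%E) (fun z => 2%:E * `|(u z)%:E|)%E.
- by move=> n; apply/measurable_EFinP; exact: measurableT_comp.
- have [N [mN N0 sub]] := ae_product S cv.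
  exists N; split => // -[x s] /= nc; apply: sub => /= cvx; apply: nc => _.
  apply: cvg_EFin; first exact: nearW.
  have : `|defect act (theta n) x s * u (x, s)| @[n --> \oo] --> `|0 * u (x, s)|.
    by apply: cvg_norm; apply: cvgMl; exact: cvx.
  by rewrite mul0r normr0.
- by apply: integrableZl => //; exact: integrable_abse.
- apply: aeW => -[x s] n _ /=; rewrite normr_id -EFinM lee_fin normrM.
  rewrite ler_wpM2r// ger0_norm ?defect_ge0//; exact: defect_le2.
rewrite integral0 => /fine_cvgP[fin0 cv0].
apply/norm_cvg0P; apply: (squeeze_cvgr _ (cvg_cst 0) cv0).
near=> n; rewrite normr_ge0/= -lee_fin fineK.
  exact: iterated_Rintegral_le.
by near: n; exact: fin0.
Unshelve. all: by end_near. Qed.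

Lemma reiter_of_ae (theta : nat -> family) :
  (forall n, borel_family (theta n)) ->
  {ae mu, forall x, forall s, defect act (theta n) x s @[n --> \oo] --> (0 : R)} ->
  reiter mu act.
Proof.
move=> mtheta cv; exists theta; split => // f [fRe fIm].
have cRe := weighted_defect_cvg0 mtheta cv fRe.
have cIm := weighted_defect_cvg0 mtheta cv fIm.
pose u n := \int[mu]_x \int[nu]_s (defect act (theta n) x s * complex.Re (f (x, s))).
pose v n := \int[mu]_x \int[nu]_s (defect act (theta n) x s * complex.Im (f (x, s))).
rewrite (_ : (fun n => _) = fun n => Num.sqrt (u n ^+ 2 + v n ^+ 2)).
  exact: (@sqrt_sum_sq_cvg0 R u v cRe cIm).
apply/funext => n; under eq_fun do rewrite csum_scale.
by [].
Qed.

Theorem liouville_reiter : liouville mu act -> reiter mu act.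
Proof.
move=> [p mp liou].
apply: (@reiter_of_ae (fun n => resolvent act (abel_parameter R n) p)).
  by move=> n; exact: borel_resolvent.
apply: filterS liou => x hx s; exact: liouville_defect.
Qed.

End reiter_from_ae.

(** * Harmonic functions of a fast mixture on one fibre *)

Section reiter_fibre.
Context (R : realType) d (X : measurableType d) (S : countMonoidType).
Variable act : X -> S -> X.
Hypothesis hact : right_borel_action act.
Local Notation T := (discrete S).
Local Notation family := (X -> probability T R).
Variable theta : nat -> family.
Local Open Scope ereal_scope.

Definition half_parameter : {x : R | (0 <= x < 1)%R} := abel_parameter R 1.

Local Notation w j := ((1 - sval half_parameter) * sval half_parameter ^+ j)%R.

Lemma w_gt0 j : (0 < w j)%R.
Proof.
have h : (0 < (2 : R)^-1 < 1)%R by rewrite invr_gt0 invf_lt1 ?ltr1n ?ltr0n.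
by case/andP: h => h0 h1; rewrite /half_parameter /= mulr_gt0 ?exprn_gt0 ?subr_gt0//; lra.
Qed.

Lemma w_ge0 j : 0 <= (w j)%:E. Proof. exact: weight_ge0. Qed.

Lemma w_sum : \sum_(j <oo) (w j)%:E = 1.
Proof. exact: (geometric_weights (svalP half_parameter)). Qed.

(** The operator N of the overview is the tail mean of the operators of theta
    (nu j). *)
Definition tail_mean K (u : nat -> \bar R) :=
  \sum_(j <oo) (w j)%:E * (if (j < K)%N then 0 else u j).

Lemma tail_mean_ge0 K u : (forall j, 0 <= u j) -> 0 <= tail_mean K u.
Proof.
move=> u0; apply: nneseries_ge0 => j _ _.
by rewrite mule_ge0 ?w_ge0//; case: ifP.
Qed.

Lemma le_tail_mean K u v : (forall j, 0 <= u j) ->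
  (forall j, (K <= j)%N -> u j <= v j) -> tail_mean K u <= tail_mean K v.
Proof.
move=> u0 uv; apply: lee_nneseries => [j _ _|j _].
  by rewrite mule_ge0 ?w_ge0//; case: ifP.
rewrite lee_wpmul2l ?w_ge0//; case: ltnP => //; exact: uv.
Qed.

Lemma tail_meanD K u v : (forall j, 0 <= u j) -> (forall j, 0 <= v j) ->
  tail_mean K (fun j => u j + v j) = tail_mean K u + tail_mean K v.
Proof.
move=> u0 v0; rewrite /tail_mean -nneseriesD; first last.
- by move=> j _ _; rewrite mule_ge0 ?w_ge0//; case: ifP.
- by move=> j _ _; rewrite mule_ge0 ?w_ge0//; case: ifP.
apply: eq_eseriesr => j _; case: ifP; first by rewrite !mule0 adde0.
by rewrite ge0_muleDr.
Qed.

Definition tau K : R := fine (tail_mean K (fun=> 1)).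

Lemma tauE K : (tau K)%:E = tail_mean K (fun=> 1).
Proof.
rewrite fineK// ge0_fin_numE ?tail_mean_ge0 ?lee01//.
apply: (@le_lt_trans _ _ 1); last by rewrite ltry.
rewrite -[leRHS]w_sum; apply: lee_nneseries => [j _ _|j _].
  by rewrite mule_ge0 ?w_ge0//; case: ifP; rewrite ?lee01.
by rewrite -[leRHS]mule1 lee_wpmul2l ?w_ge0//; case: ifP; rewrite ?lee01.
Qed.

Lemma tau_gt0 K : (0 < tau K)%R.
Proof.
rewrite -lte_fin tauE; apply: (@lt_le_trans _ _ (w K)%:E).
  by rewrite lte_fin w_gt0.
rewrite /tail_mean (@nneseriesD1 _ _ K xpredT)//; last first.
  by move=> j _; rewrite mule_ge0 ?w_ge0//; case: ifP; rewrite ?lee01.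
rewrite ltnn mule1 leeDl// nneseries_ge0// => j _ _.
by rewrite mule_ge0 ?w_ge0//; case: ifP; rewrite ?lee01.
Qed.

Lemma tail_mean_cst K (c : R) : (0 <= c)%R ->
  tail_mean K (fun=> c%:E) = (tau K * c)%:E.
Proof.
move=> c0; rewrite mulrC EFinM tauE -nneseriesZl; last first.
  by move=> j _; rewrite mule_ge0 ?w_ge0//; case: ifP; rewrite ?lee01.
apply: eq_eseriesr => j _; case: ifP; first by rewrite !mule0.
by rewrite mule1 muleC.
Qed.

Lemma avg_tail_mean (q : family) x K (u : nat -> T -> \bar R) (r : T) :
  (forall j s, 0 <= u j s) ->
  avg act q x (fun s => tail_mean K (fun j => u j s)) r =
  tail_mean K (fun j => avg act q x (u j) r).
Proof.
move=> u0; rewrite avg_series; last first.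
  by move=> j s; rewrite mule_ge0 ?w_ge0//; case: ifP.
apply: eq_eseriesr => j _; rewrite avgZ ?w_ge0//; last by move=> s; case: ifP.
by congr (_ * _); case: ifP => // _; exact: avg_cst.
Qed.

(** Its operator is Q + tau. Replacing the terms j >= K by the identity keeps
    the total mass equal to 1, so that the resolvent is a family of probability
    measures. *)
Definition truncation (nu : nat -> nat) K : family :=
  geomix_family half_parameter (fun j => if (j < K)%N then theta (nu j)
                               else @unit_family R d X S).

Lemma green_parameter_subproof K : (0 <= (1 + tau K)^-1 < 1)%R.
Proof.
have t0 := tau_gt0 K.
by rewrite invr_ge0 invf_lt1 ?ltrDl ?t0 ?andbT; lra.
Qed.

Definition green_parameter K : {x : R | (0 <= x < 1)%R} :=
  exist (fun x => is_true (0 <= x < 1)%R) _ (green_parameter_subproof K).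

(** With P' = Q + tau and a = 1 / (1 + tau), the resolvent (1 - a) (1 - a
    P')^{-1} equals tau (1 - Q)^{-1}. *)
Definition green nu K : family :=
  resolvent act (green_parameter K) (truncation nu K).

(** This makes the recursive choice of the speed possible. *)
Lemma green_ext nu nu' K : (forall j, (j < K)%N -> nu j = nu' j) ->
  green nu K = green nu' K.
Proof.
move=> e; rewrite /green /truncation; congr (resolvent _ _ (geomix_family _ _)).
by apply/funext => j; case: ifP => // /e ->.
Qed.

Definition speed_family (nu : nat -> nat) : family :=
  geomix_family half_parameter (fun j => theta (nu j)).

(** Adding tau h to both sides of h = Q h + N h gives (1 + tau) h = P' h + N h.
    Applying the Green operator G and inserting G h = (1 - a) h + a G P' h
    leaves tau h = G N h, since all terms are finite. *)
Lemma green_harmonic nu K x (h : T -> R) (C : R) (s : T) :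
  (forall t, 0 <= h t <= C)%R ->
  (forall r, (h r)%:E = avg act (speed_family nu) x (EFin \o h) r) ->
  (tau K * h s)%:E =
  tail_mean K (fun j => avg act (green nu K) x
    (avg act (theta (nu j)) x (EFin \o h)) s).
Proof.
move=> hC harm.
have h0 t : 0 <= (EFin \o h) t by rewrite /= lee_fin; case/andP: (hC t).
have C0 : (0 <= C)%R by case/andP: (hC s); apply: le_trans.
pose Rh r := tail_mean K (fun j => avg act (theta (nu j)) x (EFin \o h) r).
have Rh0 r : 0 <= Rh r by apply: tail_mean_ge0 => j; exact: avg_ge0.
(* Both sides are compared weight by weight. *)
have bal r : (1 + tau K)%:E * (h r)%:E =
    avg act (truncation nu K) x (EFin \o h) r + Rh r.
  rewrite EFinD ge0_muleDl ?lee_fin ?ltW ?tau_gt0// mul1e {1}harm.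
  rewrite -EFinM -tail_mean_cst; last by case/andP: (hC r).
  rewrite !avg_geomix// /tail_mean -!nneseriesD; try by (move=> j _ _;
    rewrite mule_ge0 ?w_ge0 ?avg_ge0//; case: ifP => // _;
    first [exact: (h0 r)|exact: avg_ge0]).
  apply: eq_eseriesr => j _; case: ifP => _; first by rewrite mule0.
  by rewrite avg_unit addeC.
have P0 r : 0 <= avg act (truncation nu K) x (EFin \o h) r by exact: avg_ge0.
have -> : tail_mean K (fun j => avg act (green nu K) x
    (avg act (theta (nu j)) x (EFin \o h)) s) = avg act (green nu K) x Rh s.
  by rewrite avg_tail_mean// => j t; exact: avg_ge0.
have := avgD act (green nu K) x s P0 Rh0.
rewrite (_ : (fun r => _ + Rh r) = fun r => (1 + tau K)%:E * (EFin \o h) r);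
  last by apply/funext => r; rewrite -bal.
have t0 := tau_gt0 K.
rewrite avgZ//; last by rewrite lee_fin; lra.
have := avg_resolvent_right hact (green_parameter K)
  (truncation nu K) x s h0.
rewrite -/(green nu K) /=.
have [gfin _] := avg_interval act (green nu K) x s hC.
have Pfin : avg act (green nu K) x (avg act (truncation nu K) x (EFin \o h)) s
    \is a fin_num.
  rewrite ge0_fin_numE ?avg_ge0//; apply: (@le_lt_trans _ _ C%:E); last exact: ltry.
  apply: avg_le => // t; apply: avg_le => // t'.
  by rewrite lee_fin; case/andP: (hC t').
rewrite -(fineK gfin) -(fineK Pfin).
move: (fine _) (fine _) => q g.
rewrite -!EFinM -!EFinD => -[geq].
case: (avg act _ x Rh s) => [rho| |] //= => -[eqn]; congr EFin.
have : ((1 + tau K) * g = tau K * h s + q)%R.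
  by rewrite geq; field; lra.
by rewrite eqn; lra.
Qed.

(** By [green_harmonic], tau h(s) is a tail mean of averages under G of the
    functions avg (theta (nu j)) h, and these differ from their values at 1 by
    at most C times the defects. *)
Lemma green_oscillation nu K x (h : T -> R) (C eps : R) (s : T) :
  (forall t, 0 <= h t <= C)%R -> (0 <= eps)%R ->
  (forall r, (h r)%:E = avg act (speed_family nu) x (EFin \o h) r) ->
  (forall j, (K <= j)%N ->
    avg act (green nu K) x (fun t => (defect act (theta (nu j)) x t)%:E) s
      <= eps%:E) ->
  let c := tail_mean K (fun j => avg act (theta (nu j)) x (EFin \o h) (1%g : S)) in
  (tau K * h s)%:E <= c + (tau K * (C * eps))%:E /\
  c <= (tau K * h s)%:E + (tau K * (C * eps))%:E.
Proof.
move=> hC eps0 harm small c.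
have C0 : (0 <= C)%R by case/andP: (hC s); apply: le_trans.
have hCE t : 0 <= (EFin \o h) t <= C%:E by rewrite /= !lee_fin.
have h0 t : 0 <= (EFin \o h) t by case/andP: (hCE t).
have D0 j t : 0 <= (C * defect act (theta (nu j)) x t)%:E.
  by rewrite lee_fin mulr_ge0 ?defect_ge0.
have ineq j t := le_avg_defect hact (theta (nu j)) x t hCE.
have smallC j : (K <= j)%N -> avg act (green nu K) x
    (fun t => (C * defect act (theta (nu j)) x t)%:E) s <= (C * eps)%:E.
  move=> Kj; under eq_fun do rewrite EFinM.
  rewrite avgZ ?lee_fin//; last by move=> t; rewrite lee_fin defect_ge0.
  by rewrite EFinM lee_wpmul2l ?lee_fin// small.
have Ce0 : (0 <= C * eps)%R by rewrite mulr_ge0.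
rewrite (green_harmonic _ _ hC harm) -!tail_mean_cst//.
have avg0 j t : 0 <= avg act (theta (nu j)) x (EFin \o h) t by exact: avg_ge0.
have gavg0 j : 0 <= avg act (green nu K) x (avg act (theta (nu j)) x (EFin \o h)) s.
  exact: avg_ge0.
rewrite /c -!tail_meanD//; split; apply: le_tail_mean => // j Kj.
- apply: le_trans (leeD2l _ (smallC _ Kj)).
  rewrite -[X in _ <= X + _](@avg_cst _ _ _ _ act (green nu K) x _ s)//.
  by rewrite -avgD//; apply: le_avg => // t; have [] := ineq j t.
- apply: le_trans (leeD2l _ (smallC _ Kj)).
  rewrite -[leLHS](@avg_cst _ _ _ _ act (green nu K) x _ s)//.
  by rewrite -avgD//; apply: le_avg => // t; have [] := ineq j t.
Qed.

Lemma harmonic_constant nu x (h : T -> R) (C : R) (s : T) :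
  (forall t, 0 <= h t <= C)%R ->
  (forall r, (h r)%:E = avg act (speed_family nu) x (EFin \o h) r) ->
  (forall eps : R, (0 < eps)%R -> exists K, forall j, (K <= j)%N ->
    avg act (green nu K) x (fun t => (defect act (theta (nu j)) x t)%:E) s
      <= eps%:E /\
    avg act (green nu K) x (fun t => (defect act (theta (nu j)) x t)%:E) (1%g : S)
      <= eps%:E) ->
  h s = h (1%g : S).
Proof.
move=> hC harm small.
have C0 : (0 <= C)%R by case/andP: (hC s); apply: le_trans.
apply/eqP; rewrite -subr_eq0 -normr_le0; apply/ler_addgt0Pl => e e0.
have C1 : (0 < 2 * (C + 1))%R by lra.
have [K smallK] := small (e / (2 * (C + 1)))%R (divr_gt0 e0 C1).
have eps0 : (0 <= e / (2 * (C + 1)))%R by rewrite ltW ?divr_gt0.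
have [] := green_oscillation hC eps0 harm (fun j Kj => (smallK j Kj).1).
have [] := green_oscillation hC eps0 harm (fun j Kj => (smallK j Kj).2).
set c := tail_mean _ _; have t0 := tau_gt0 K.
set k := (tau K * (C * _))%R.
have ke : (2 * k <= tau K * e)%R.
  rewrite /k mulrCA ler_wpM2l ?(ltW t0)//.
  rewrite !mulrA ler_pdivrMr//; nra.
case: c => [c| |] //; rewrite -!EFinD !lee_fin => ? ? ? ?.
rewrite addr0 -(ler_pM2l t0) -[X in (X * `|_|)%R]gtr0_norm// -normrM ler_norml.
by rewrite !mulrBr; apply/andP; split; lra.
Qed.

End reiter_fibre.

(** * The Reiter property in terms of nonnegative integrals *)

Section reiter_integrals.
Context (R : realType) d (X : measurableType d) (S : countMonoidType).
Variables (mu : {sigma_finite_measure set X -> \bar R}) (act : X -> S -> X).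
Hypothesis hact : right_borel_action act.
Local Notation T := (discrete S).
Local Notation family := (X -> probability T R).
Local Notation nu := (dcounting S R).

Definition reiter_sequence (theta : nat -> family) :=
  forall f : X * T -> R[i], cintegrable (mu \x nu)%E f ->
    Normc.normc (cintegral mu (fun x => csum (fun s : T =>
      (l1dist (theta n x) (translate s (theta n (act x s))))%:C%C * f (x, s))))
      @[n --> \oo] --> (0 : R).

Local Open Scope ereal_scope.

(** The Reiter property for the test function f(x, t) = 1_F(x) q_x(t), which is
    integrable because q_x is a probability measure and F has finite measure. *)
Lemma reiter_family_cvg (theta : nat -> family) (q : family) (F : set X) :
  reiter_sequence theta -> borel_family q -> measurable F -> mu F < +oo ->
  (forall n, borel_family (theta n)) ->
  (\int[mu]_x ((\1_F x)%:E * \int[q x]_t (defect act (theta n) x t)%:E))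
    @[n --> \oo] --> 0.
Proof.
move=> rth mq mF Foo mtheta.
pose u (z : X * T) : R := (\1_F z.1 * mass (q z.1) z.2)%R.
have mu_ : measurable_fun [set: X * T] u.
  apply: measurable_fun_sections => s.
  by apply: measurable_funM; [exact: measurable_indic|exact: mq].
have u0 z : (0 <= u z)%R by rewrite mulr_ge0 ?mass_ge0.
have iu : (mu \x nu).-integrable [set: X * T] (EFin \o u).
  apply/integrableP; split; first exact/measurable_EFinP.
  rewrite (_ : (fun z => _) = EFin \o u); last first.
    by apply/funext => z /=; rewrite ger0_norm.
  rewrite ge0_fubini_discrete//; [|exact/measurable_EFinP].
  rewrite (eq_integral (fun x => (\1_F x)%:E)); last first.
    move=> x _; rewrite /u /=; under eq_integral do rewrite EFinM.
    rewrite ge0_integralZl//.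
      rewrite (_ : \int[nu]_s (mass (q x) s)%:E = 1) ?mule1//.
      rewrite -[RHS](integral_probability_cst (q x) lee01) integral_mass//.
      by apply: eq_integral => s _; rewrite mul1e.
    by move=> s _; rewrite lee_fin mass_ge0.
  by rewrite integral_indic// setIT.
have ci : cintegrable (mu \x nu) (fun z => (u z)%:C%C).
  split; first exact: iu.
  rewrite (_ : _ \o _ = cst 0); first exact: integrable0.
  by apply/funext.
have innerE n x : \int[nu]_s (defect act (theta n) x s * u (x, s))%:E =
    (\1_F x)%:E * \int[q x]_t (defect act (theta n) x t)%:E.
  rewrite integral_mass; last by move=> t; rewrite lee_fin defect_ge0.
  rewrite -ge0_integralZl//;
    try by (move=> t _; rewrite mule_ge0// lee_fin ?defect_ge0 ?mass_ge0).
  by apply: eq_integral => t _; rewrite /u /= -!EFinM mulrCA.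
have bound n x : (\1_F x)%:E * \int[q x]_t (defect act (theta n) x t)%:E
    <= 2%:E * (\1_F x)%:E.
  rewrite muleC lee_wpmul2r// ?lee_fin//.
  have two0 : 0 <= 2%:E :> \bar R by rewrite lee_fin.
  rewrite -[leRHS](integral_probability_cst (q x) two0).
  by apply: le_integral_discrete => t; rewrite lee_fin ?defect_ge0 ?defect_le2.
have pos n x : 0 <= (\1_F x)%:E * \int[q x]_t (defect act (theta n) x t)%:E.
  by rewrite mule_ge0 ?lee_fin//; apply: integral_ge0 => t _; rewrite lee_fin defect_ge0.
have inner n x : ((\int[nu]_s (defect act (theta n) x s * u (x, s)))%R)%:E =
    (\1_F x)%:E * \int[q x]_t (defect act (theta n) x t)%:E.
  rewrite /Rintegral fineK ?innerE// ge0_fin_numE//.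
  by apply: (le_lt_trans (bound n x)); rewrite -EFinM ltry.
have mE n : measurable_fun [set: X]
    (fun x => (\1_F x)%:E * \int[q x]_t (defect act (theta n) x t)%:E).
  apply: emeasurable_funM; first by apply/measurable_EFinP; exact: measurable_indic.
  apply: measurable_family_integral => // [x t|t].
    by rewrite lee_fin defect_ge0.
  by apply/measurable_EFinP; exact: measurable_defect.
have fin n : \int[mu]_x ((\1_F x)%:E * \int[q x]_t (defect act (theta n) x t)%:E)
    \is a fin_num.
  rewrite ge0_fin_numE; last exact: integral_ge0.
  apply: (@le_lt_trans _ _ (\int[mu]_x (2%:E * (\1_F x)%:E))).
    apply: ge0_le_integral => //.
    by apply: measurable_funeM; apply/measurable_EFinP; exact: measurable_indic.
  rewrite ge0_integralZl//; last first.
    by apply/measurable_EFinP; exact: measurable_indic.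
  by rewrite integral_indic// setIT lte_mul_pinfty// lee_fin.
apply: cvg_EFin; first by apply: nearW => n; exact: fin.
apply: cvg_trans (rth _ ci); apply: near_eq_cvg; apply: nearW => n.
rewrite /Normc.normc /cintegral /=.
rewrite [X in (_ + X ^+ 2)%R](_ : _ = 0%R); last first.
  rewrite (_ : (fun x => _) = cst 0%R) ?Rintegral_cst ?mul0r//.
  apply/funext => x; rewrite /csum /cintegral /=.
  rewrite (_ : (fun x => _) = cst 0%R) ?Rintegral_cst ?mul0r//.
  by apply/funext => s /=; rewrite mulr0 mul0r addr0.
rewrite expr0n addr0 sqrtr_sqr /Rintegral.
rewrite (eq_integral
  (fun x => (\1_F x)%:E * \int[q x]_t (defect act (theta n) x t)%:E)).
  by rewrite ger0_norm// fine_ge0//; exact: integral_ge0.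
move=> x _; rewrite -inner; congr EFin; rewrite /csum /cintegral /=.
by apply: eq_Rintegral => s _ /=; rewrite mul0r subr0.
Qed.

End reiter_integrals.

(** * Choice of the mixture, and the Liouville property *)

Section harmonic_shift.
Context (R : realType) d (X : measurableType d) (S : countMonoidType).
Variable act : X -> S -> X.
Local Notation T := (discrete S).

(** Adding the bound M makes a bounded harmonic function nonnegative, hence
    accessible to the integral calculus of nonnegative functions. *)
Lemma harmonic_shift (p : X -> probability T R) x (u : T -> R) (M : R) :
  (forall t, `|u t| <= M) ->
  (forall r, u r = \int[p (act x r)]_t u (r * t)%g) ->
  forall r, (u r + M)%:E = avg act p x (EFin \o (fun t => u t + M)) r.
Proof.
move=> uM hu r; rewrite /avg /=.
have iu : (p (act x r)).-integrable [set: T] (fun t => (u (r * t)%g)%:E).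
  apply: (@measurable_bounded_integrable _ _ _ _ (fun t => u (r * t)%g)) => //.
    exact: fin_num_fun_lty.
  exists M; split; first exact: num_real.
  by move=> y My t _ /=; rewrite (le_trans (uM _))// ltW.
have ic : (p (act x r)).-integrable [set: T] (cst M%:E).
  exact: finite_measure_integrable_cst.
under eq_integral do rewrite EFinD.
rewrite integralD// integral_cst// [X in (_ * X)%E](_ : _ = 1%E) ?mule1.
  by rewrite EFinD {1}hu /Rintegral fineK//; exact: integrable_fin_num.
exact: probability_setT.
Qed.

End harmonic_shift.

Lemma cvge0_eventually_le (R : realType) (u : nat -> \bar R) (e : R) : 0 < e ->
  u n @[n --> \oo] --> 0%E -> \forall n \near \oo, (u n <= e%:E)%E.
Proof.
move=> e0 /fine_cvgP[fin cv].
have cve := @cvgr_le R nat \oo _ _ 0 cv e e0.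
near=> n; have finn : u n \is a fin_num by near: n.
rewrite -(fineK finn) lee_fin; near: n; exact: cve.
Unshelve. all: by end_near. Qed.

Section reiter_liouville.
Context (R : realType) d (X : measurableType d) (S : countMonoidType).
Variables (mu : {sigma_finite_measure set X -> \bar R}) (act : X -> S -> X).
Hypothesis hact : right_borel_action act.
Local Notation T := (discrete S).
Local Notation family := (X -> probability T R).
Variable theta : nat -> family.
Hypothesis mtheta : forall n, borel_family (theta n).
Hypothesis rtheta : reiter_sequence mu act theta.
Variable F : nat -> set X.
Hypothesis mF : forall i, measurable (F i).
Hypothesis Foo : forall i, (mu (F i) < +oo)%E.
Local Notation w j :=
  ((1 - sval (half_parameter R)) * sval (half_parameter R) ^+ j)%R.
Local Open Scope ereal_scope.

(** The law, seen in the fibre over x, of the walk started at s. *)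
Definition translated_family (q : family) (s : T) : family :=
  convolve act (fun=> @dirac _ T s R) q.

Lemma integral_translated_family (q : family) s x (u : T -> \bar R) :
  (forall t, 0 <= u t) ->
  \int[translated_family q s x]_t u t = avg act q x u s.
Proof.
move=> u0; rewrite -(avg1 hact) avg_convolve// /avg integral_dirac//.
by rewrite diracT mul1e mul1g.
Qed.

Lemma borel_translated_family q s :
  borel_family q -> borel_family (translated_family q s).
Proof. by move=> mq; apply: (borel_convolve hact) => // t; exact: measurable_cst. Qed.

Lemma borel_green nu K : borel_family (green act theta nu K).
Proof.
apply: (borel_resolvent hact); apply: (borel_geomix hact) => j.
by case: ifP => _; [exact: mtheta|exact: borel_unit].
Qed.

(** The first index selects a set F i of finite measure, the second a cut-off K
    of the Green operator, the third a point of S. Since all three range up to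
    j, any fixed i and s are covered from some stage on, and the cut-off K is
    covered from stage K on. *)
Definition green_defect nu j n (z : 'I_j.+1 * 'I_j.+1 * 'I_j.+1) x : \bar R :=
  (\1_(F z.1.1) x)%:E * avg act (green act theta nu z.1.2) x
    (fun t => (defect act (theta n) x t)%:E) (point_of S z.2).

Definition total_defect nu j n x : \bar R := \sum_z @green_defect nu j n z x.

Lemma green_defect_ge0 nu j n z x : 0 <= @green_defect nu j n z x.
Proof.
rewrite mule_ge0 ?lee_fin//; apply: avg_ge0 => t.
by rewrite lee_fin defect_ge0.
Qed.

Lemma total_defect_ge0 nu j n x : 0 <= total_defect nu j n x.
Proof. by apply: sume_ge0 => z _; exact: green_defect_ge0. Qed.

Lemma measurable_green_defect nu j n z :
  measurable_fun [set: X] (@green_defect nu j n z).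
Proof.
apply: emeasurable_funM; first by apply/measurable_EFinP; exact: measurable_indic.
apply: (measurable_avg hact) => //; first exact: borel_green.
  by move=> x t; rewrite lee_fin defect_ge0.
by move=> t; apply/measurable_EFinP; exact: measurable_defect.
Qed.

Lemma total_defect_cvg nu j :
  \int[mu]_x total_defect nu j n x @[n --> \oo] --> 0.
Proof.
rewrite (_ : (fun n => _) =
    fun n => \sum_(z : 'I_j.+1 * 'I_j.+1 * 'I_j.+1)
      \int[mu]_x green_defect nu n z x); last first.
  apply/funext => n; rewrite ge0_integral_sum//.
    by move=> z; exact: measurable_green_defect.
  by move=> z x _; exact: green_defect_ge0.
rewrite [X in _ --> X](_ : _ = \sum_(z : 'I_j.+1 * 'I_j.+1 * 'I_j.+1) 0);
  last by rewrite big1.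
apply: cvg_nnesum => z _.
  by apply: nearW => n; apply: integral_ge0 => x _; exact: green_defect_ge0.
have mg := borel_translated_family (point_of S z.2) (borel_green nu z.1.2).
have := reiter_family_cvg hact rtheta mg (mF z.1.1) (Foo z.1.1) mtheta.
apply: cvg_trans; apply: near_eq_cvg; apply: nearW => n; apply: eq_integral => x _.
by rewrite integral_translated_family// => t; rewrite lee_fin defect_ge0.
Qed.

Lemma total_defect_ext nu nu' j n : (forall i, (i < j)%N -> nu i = nu' i) ->
  total_defect nu j n = total_defect nu' j n.
Proof.
move=> e; apply/funext => x; apply: eq_bigr => z _; rewrite /green_defect.
by rewrite (green_ext act theta (nu' := nu'))// => i iz; apply: e;
  rewrite (leq_trans iz)// -ltnS.
Qed.

Lemma fast_index nu j : exists n, \int[mu]_x total_defect nu j n x <= (w j)%:E.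
Proof.
have [n _ nP] := cvge0_eventually_le (w_gt0 R j) (total_defect_cvg nu j).
by exists n; apply: nP => /=.
Qed.

(** The values of the speed are chosen one after the other: by
    [total_defect_ext] the integral to be made small at stage j depends only on
    those chosen before. *)
Lemma fast_speed : exists nu : nat -> nat,
  forall j, \int[mu]_x total_defect nu j (nu j) x <= (w j)%:E.
Proof.
have [N NP] := choice (fun l : seq nat => fast_index (nth 0%N l) (size l)).
pose L := fix L j := if j is j'.+1 then rcons (L j') (N (L j')) else [::].
have sL j : size (L j) = j by elim: j => //= j ih; rewrite size_rcons ih.
have nL i j : (i < j)%N -> nth 0%N (L j) i = N (L i).
  elim: j => // j ih; rewrite ltnS leq_eqVlt => /orP[/eqP ->|ij] /=.
    by rewrite nth_rcons sL ltnn eqxx.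
  by rewrite nth_rcons sL ij ih.
exists (fun j => N (L j)) => j.
rewrite (total_defect_ext _ (nu' := nth 0%N (L j))); last by move=> i /nL ->.
by have := NP (L j); rewrite sL.
Qed.

(** Borel-Cantelli: the weights w j have sum 1, so the series has finite
    integral. *)
Lemma ae_total_defect nu :
  (forall j, \int[mu]_x total_defect nu j (nu j) x <= (w j)%:E) ->
  {ae mu, forall x, \sum_(j <oo) total_defect nu j (nu j) x < +oo}.
Proof.
move=> nuP; pose Q x := \sum_(j <oo) total_defect nu j (nu j) x.
have Q0 x : 0 <= Q x by apply: nneseries_ge0 => j _ _; exact: total_defect_ge0.
have mQ j : measurable_fun [set: X] (total_defect nu j (nu j)).
  by apply: emeasurable_sum => z; exact: measurable_green_defect.
have iQ : mu.-integrable [set: X] Q.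
  apply/integrableP; split.
    apply: ge0_emeasurable_sum => // j x _ _; exact: total_defect_ge0.
  under eq_integral do rewrite gee0_abs//.
  rewrite /Q integral_nneseries//; last by move=> j x _; exact: total_defect_ge0.
  apply: (@le_lt_trans _ _ (\sum_(j <oo) (w j)%:E)).
    apply: lee_nneseries => // j _ _; apply: integral_ge0 => x _.
    exact: total_defect_ge0.
  by rewrite w_sum ltry.
have := integrable_ae measurableT iQ; apply: filterS => x /(_ I).
by rewrite ge0_fin_numE.
Qed.

Lemma le_total_defect nu j n x i K s : F i x -> (i <= j)%N -> (K <= j)%N ->
  (pickle s <= j)%N ->
  avg act (green act theta nu K) x (fun t => (defect act (theta n) x t)%:E) s <=
  total_defect nu j n x.
Proof.
move=> Fx ij Kj sj.
pose z : 'I_j.+1 * 'I_j.+1 * 'I_j.+1 := (inord i, inord K, inord (pickle s)).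
rewrite /total_defect (bigD1 z)//= -[leLHS]adde0; apply: leeD; last first.
  by apply: sume_ge0 => z' _; exact: green_defect_ge0.
by rewrite /green_defect /= !inordK ?ltnS// indicE mem_set// mul1e point_of_pickle.
Qed.

(** From some stage K on the terms of the convergent series are small, and each
    term of stage j >= K contains the averaged defect with cut-off K. *)
Lemma small_green_defect nu x s i : F i x ->
  \sum_(j <oo) total_defect nu j (nu j) x < +oo ->
  forall eps : R, (0 < eps)%R -> exists K, forall j, (K <= j)%N ->
    avg act (green act theta nu K) x
      (fun t => (defect act (theta (nu j)) x t)%:E) s <= eps%:E /\
    avg act (green act theta nu K) x
      (fun t => (defect act (theta (nu j)) x t)%:E) (1%g : S) <= eps%:E.
Proof.
move=> Fx fin eps e0.
have tail := @nneseries_tail_cvg _ _ xpredT fin (fun k _ => total_defect_ge0 _ _ _ _).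
have [N _ NP] := cvge0_eventually_le e0 tail.
pose K := maxn N (maxn i (maxn (pickle (s : T)) (pickle ((1%g : S) : T)))).
exists K => j Kj.
have : total_defect nu j (nu j) x <= eps%:E.
  apply: le_trans (NP K _); last by rewrite /= leq_max leqnn.
  apply: (@le_trans _ _ (\sum_(K <= k < j.+1) total_defect nu k (nu k) x)).
    rewrite big_nat_recr//= leeDr// sume_ge0// => k _; exact: total_defect_ge0.
  by apply: nneseries_lim_ge => k _ _; exact: total_defect_ge0.
move: (Kj); rewrite !geq_max => /and4P[_ ij sj oj] small.
by split; apply: le_trans small; apply: (@le_total_defect _ _ _ _ i).
Qed.

End reiter_liouville.

(** * The equivalence *)

Section main.
Context (R : realType) d (X : measurableType d) (S : countMonoidType).
Variables (mu : {sigma_finite_measure set X -> \bar R}) (act : X -> S -> X).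
Hypothesis hact : right_borel_action act.
Local Notation T := (discrete S).

Lemma real_harmonic_constant (theta : nat -> X -> probability T R) nu x
    (u : T -> R) (M : R) :
  (forall s (eps : R), 0 < eps -> exists K, forall j, (K <= j)%N ->
    (avg act (green act theta nu K) x
      (fun t => (defect act (theta (nu j)) x t)%:E) s <= eps%:E)%E /\
    (avg act (green act theta nu K) x
      (fun t => (defect act (theta (nu j)) x t)%:E) (1%g : S) <= eps%:E)%E) ->
  (forall t, `|u t| <= M) ->
  (forall r, u r = \int[speed_family theta nu (act x r)]_t u (r * t)%g) ->
  forall s, u s = u (1%g : S).
Proof.
move=> small uM hu s.
have hC t : 0 <= u t + M <= M + M.
  by have := uM t; rewrite ler_norml => /andP[? ?]; apply/andP; split; lra.
have := harmonic_constant hact hC (harmonic_shift uM hu) (small s).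
by move/addIr.
Qed.

Lemma normc_Re (z : R[i]) : `|complex.Re z| <= Normc.normc z.
Proof.
case: z => a b; rewrite /Normc.normc /= -(sqrtr_sqr a); apply: ler_wsqrtr.
by rewrite lerDl sqr_ge0.
Qed.

Lemma normc_Im (z : R[i]) : `|complex.Im z| <= Normc.normc z.
Proof.
case: z => a b; rewrite /Normc.normc /= -(sqrtr_sqr b); apply: ler_wsqrtr.
by rewrite lerDr sqr_ge0.
Qed.

Theorem reiter_liouville : reiter mu act -> liouville mu act.
Proof.
move=> [theta [mtheta rtheta]].
have [F FT /all_and2[mF Foo]] := sigma_finiteT mu.
have [nu nuP] := fast_speed hact mtheta rtheta mF Foo.
exists (speed_family theta nu); first by apply: (borel_geomix hact).
apply: filterS (ae_total_defect hact mtheta mF nuP) => x fin f [M fM].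
move=> /fibre_harmonicP hf.
have [i _ Fx] : (\bigcup_i F i) x by rewrite -FT.
have small s := small_green_defect s Fx fin.
exists (f 1%g) => s.
have uRe t : `|complex.Re (f t)| <= M by apply: le_trans (normc_Re _) (fM t).
have uIm t : `|complex.Im (f t)| <= M by apply: le_trans (normc_Im _) (fM t).
have eRe := real_harmonic_constant small uRe (fun r => (hf r).1) s.
have eIm := real_harmonic_constant small uIm (fun r => (hf r).2) s.
by move: eRe eIm; case: (f s) => a b; case: (f 1%g) => a' b' /= -> ->.
Qed.

End main.

Theorem theorem6p5 (R : realType) (d : measure_display) (X : measurableType d)
    (mu : {sigma_finite_measure set X -> \bar R})
    (S : countMonoidType) (act : X -> S -> X) :
  analytic_borel_space R X ->
  right_borel_action act ->
  liouville mu act <-> reiter mu act.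
Proof.
move=> _ hact; split; first exact: (liouville_reiter hact).
exact: (reiter_liouville hact).
Qed.
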